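(* Let $\boldsymbol\Theta=\mathbb{R}^+\times\mathbb{R}^+$, let $x_c\in\mathbb{R}$ be known, and let $\boldsymbol\alpha^\star=(\alpha_1^\star,\alpha_2^\star)=(\tilde F,\tilde B)\in\boldsymbol\Theta$ be the true parameters. Let $\mathbf{I}=(I_1,\dots,I_n)$ have independent components $I_i\sim\mathrm{Poisson}(\lambda_i)$ with $\lambda_i=\lambda_i(x_c,\tilde F)=\tilde F\,g_i(x_c)+\tilde B$, so that $\bar{\mathbf{I}}=\mathbb{E}\{\mathbf{I}\}=(\lambda_1,\dots,\lambda_n)^\top$ and the covariance matrix of $\mathbf{I}$ is $K_{\mathbf{I}}=\mathrm{diag}(\lambda_1,\dots,\lambda_n)$. Consider the maximum likelihood estimator $$\tau_{ML}(\mathbf{I})=\operatorname*{argmin}_{\boldsymbol\alpha\in\boldsymbol\Theta}J_{ML}(\boldsymbol\alpha,\mathbf{I}),\qquad J_{ML}(\boldsymbol\alpha,\mathbf{I})=-\ln L(\mathbf{I};x_c,\boldsymbol\alpha),$$ $$L(\mathbf{I};x_c,\boldsymbol\alpha)=\prod_{i=1}^n\frac{e^{-(\alpha_1g_i(x_c)+\alpha_2)}\,(\alpha_1g_i(x_c)+\alpha_2)^{I_i}}{I_i!}.$$ Then for any $j\in\{1,2\}$ one can determine $\epsilon'_{ML,j}>0$ and $\beta_{ML,j}$ such that $$\big|\mathbb{E}\{\tau_{ML,j}(\mathbf{I})\}-\alpha^\star_j\big|\le\epsilon'_{ML,j},$$ $$\mathrm{Var}(\tau_{ML,j}(\mathbf{I}))\in\Big[[\sigma^2_{ML}]_{(j,j)}-\beta_{ML,j},\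 [\sigma^2_{ML}]_{(j,j)}+\beta_{ML,j}\Big],$$ with $$\sigma^2_{ML}=\tau_{ML}'(\bar{\mathbf{I}})\,K_{\mathbf{I}}\,[\tau_{ML}'(\bar{\mathbf{I}})]^\top,$$ $$\tau_{ML}'(\bar{\mathbf{I}})=-\big[\nabla^{20}J_{ML}(\tau_{ML}(\bar{\mathbf{I}}),\bar{\mathbf{I}})\big]^{-1}\,\nabla^{11}J_{ML}(\tau_{ML}(\bar{\mathbf{I}}),\bar{\mathbf{I}}),$$ where $$\nabla^{11}J_{ML}(\tau_{ML}(\bar{\mathbf{I}}),\bar{\mathbf{I}})=\begin{bmatrix}\frac{-g_1(x_c)}{\lambda_1}&\cdots&\frac{-g_n(x_c)}{\lambda_n}\\ \frac{-1}{\lambda_1}&\cdots&\frac{-1}{\lambda_n}\end{bmatrix},$$ $$\nabla^{20}J_{ML}(\tau_{ML}(\bar{\mathbf{I}}),\bar{\mathbf{I}})=\begin{bmatrix}\sum_{i}\frac{g_i^2(x_c)}{\lambda_i}&\sum_{i}\frac{g_i(x_c)}{\lambda_i}\\ \sum_{i}\frac{g_i(x_c)}{\lambda_i}&\sum_{i}\frac1{\lambda_i}\end{bmatrix}.$$ The quantities $\epsilon'_{ML,j}$ and $\beta_{ML,j}$ are $$\epsilon'_{ML,j}=\big|\tau_{ML,j}(\bar{\mathbf{I}})-\alpha^\star_j\big|+\max_{t\in[0,1]}\big|\mathbb{E}\{e_j^{(t)}\}\big|,$$ $$\beta_{ML,j}=\max_{t\in[0,1]}\mathbb{E}\{(e_j^{(t)})^2\}+2\max_{t\in[0,1]}\Big|\mathbb{E}\Big\{\big([\tau_{ML}'(\bar{\mathbf{I}})]_{(j,\cdot)}(\mathbf{I}-\bar{\mathbf{I}})\big)\,e_j^{(t)}\Big\}\Big|,$$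 $$e_j^{(t)}=\frac12\sum_{i=1}^n\sum_{h=1}^n\frac{\partial^2\tau_{ML,j}}{\partial I_i\,\partial I_h}\big(\bar{\mathbf{I}}+t(\mathbf{I}-\bar{\mathbf{I}})\big)\,(I_i-\bar I_i)(I_h-\bar I_h).$$
   Context: Pixel model: $\phi(\cdot,\sigma)$ is the point spread function, a probability density on $\mathbb{R}$ (taken to be the centered Gaussian density with standard deviation $\sigma$), $x_1,\dots,x_n$ are pixel centers with $x_{i+1}-x_i=\Delta x>0$, and $g_i(x_c)=\int_{x_i-\Delta x/2}^{x_i+\Delta x/2}\phi(x-x_c,\sigma)\,dx$. Here $x_c$ is the source position, $\tilde F$ the source flux and $\tilde B$ the (homogeneous) background per pixel; $I_i$ is the photon count in pixel $i$. For a real function $f(\boldsymbol\alpha,\mathbf{I})$ of $\boldsymbol\alpha\in\mathbb{R}^2$ and $\mathbf{I}\in\mathbb{R}^n$, $\nabla^{20}f$ is the $2\times2$ matrix with entries $\frac{\partial^2 f}{\partial\alpha_k\partial\alpha_l}$ and $\nabla^{11}f$ is the $2\times n$ matrix with entries $\frac{\partial^2 f}{\partial\alpha_k\partial I_i}$; derivatives are taken first and then evaluated at the indicated point. The term $\ln(I_i!)$ in $J_{ML}$ does not depend on $\boldsymbol\alpha$ and plays no role in the minimization or in these derivatives, so $\tau_{ML}$ and its derivatives make sense at non-integer $\mathbf{I}$ such as $\bar{\mathbf{I}}$. $\tau_{ML}'(\bar{\mathbf{I}})$ is the $2\times n$ Jacobian of $\tau_{ML}$ at $\bar{\mathbf{I}}$.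 $[A]_{(j,\cdot)}$ is the $j$-th row of $A$; sums over $i$ run over $1,\dots,n$. Expectations and variances are with respect to the Poisson law of $\mathbf{I}$ above.
   Formalization: The estimator is free where no minimizer exists; an invertible Hessian, C^2 regularity of the estimator on the segments (t<1, continuity at t=1) and a finite max of E{e^2} are assumed; max is a supremum; epsilon'>0 becomes epsilon'>=0, strict unless E{e^(t)}=0 for all t. *)

(* Defs.v *)
From HB Require Import structures.
From mathcomp Require Import all_boot all_order all_algebra.
From mathcomp Require Import all_classical all_reals all_analysis.

Set Implicit Arguments.
Unset Strict Implicit.
Unset Printing Implicit Defensive.

Import Order.TTheory GRing.Theory Num.Theory.
Import numFieldNormedType.Exports.

Local Open Scope classical_set_scope.
Local Open Scope ring_scope.

Section calculus.
Context {R : realType}.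

Definition is_argmin {T : Type} (D : set T) (f : T -> R) (a : T) : Prop :=
  D a /\ forall b, D b -> f a <= f b.

Definition partial {m : nat} (i : 'I_m) (f : 'rV[R]_m -> R) (p : 'rV[R]_m) : R :=
  'D_(delta_mx 0 i) f p.

Definition C2_near {m : nat} (f : 'rV[R]_m -> R) (p : 'rV[R]_m) : Prop :=
  \forall q \near p,
    [/\ differentiable f q,
        forall i, differentiable (partial i f) q
      & forall i h, {for q, continuous (partial i (partial h f))}].

Definition nabla20 {m n : nat} (f : 'rV[R]_m -> 'rV[R]_n -> R)
    (a : 'rV[R]_m) (I : 'rV[R]_n) : 'M[R]_m :=
  \matrix_(k, l) partial k (partial l (fun b => f b I)) a.

Definition nabla11 {m n : nat} (f : 'rV[R]_m -> 'rV[R]_n -> R)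
    (a : 'rV[R]_m) (I : 'rV[R]_n) : 'M[R]_(m, n) :=
  \matrix_(k, i) partial k (fun b => partial i (f b) I) a.

(* The library's [jacobian] acts on row vectors, hence the transposition. *)
Definition jacobian_col {m n : nat} (f : 'rV[R]_n -> 'rV[R]_m)
    (p : 'rV[R]_n) : 'M[R]_(m, n) := (jacobian f p)^T.

Definition segment_point {n : nat} (p q : 'rV[R]_n) (t : R) : 'rV[R]_n :=
  p + t *: (q - p).

Definition taylor2 {n : nat} (f : 'rV[R]_n -> R) (p : 'rV[R]_n) (t : R)
    (q : 'rV[R]_n) : R :=
  2^-1 * \sum_i \sum_h partial i (partial h f) (segment_point p q t) *
           (q 0 i - p 0 i) * (q 0 h - p 0 h).

End calculus.

Section probability_notions.
Context {d} {T : measurableType d} {R : realType}.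

Definition mutually_independent {d'} {S : measurableType d'} {n : nat}
    (P : probability T R) (X : 'I_n -> {mfun T >-> S}) : Prop :=
  forall (K : {set 'I_n}) (A : 'I_n -> set S), (forall i, measurable (A i)) ->
    P (\bigcap_(i in [set i | i \in K]) (X i @^-1` A i)) =
    (\prod_(i in K) P (X i @^-1` A i))%E.

(* The second argument of [poisson_prob] is a dummy. *)
Definition is_poisson (P : probability T R) (N : {mfun T >-> nat}) (rate : R) :
    Prop :=
  forall U : set nat, distribution P N U = poisson_prob rate 0%N U.

Definition real_counts {n : nat} (X : 'I_n -> {mfun T >-> nat}) (w : T) :
    'rV[R]_n := \row_i (X i w)%:R.

End probability_notions.

Section pixel_model.
Context {R : realType} {n : nat}.

Definition pixel_response (sigma dx : R) (x : 'I_n -> R) (xc : R) (i : 'I_n) :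
    R :=
  \int[lebesgue_measure]_(u in `[x i - dx / 2, x i + dx / 2])
    normal_pdf 0 sigma (u - xc).

Definition param_space : set 'rV[R]_2 := [set a | 0 < a 0 0 /\ 0 < a 0 1].

Definition intensity (g : 'I_n -> R) (a : 'rV[R]_2) (i : 'I_n) : R :=
  a 0 0 * g i + a 0 1.

Definition likelihood (g : 'I_n -> R) (k : 'I_n -> nat) (a : 'rV[R]_2) : R :=
  \prod_i (expR (- intensity g a i) * intensity g a i ^+ k i / (k i)`!%:R).

(* Minus the log-likelihood without the terms ln (I_i!), which do not depend on
   the parameters; this makes sense for non-integer I. On actual counts it
   differs from - ln (likelihood) by a constant: see [J_ML_likelihood]. *)
Definition J_ML (g : 'I_n -> R) (a : 'rV[R]_2) (I : 'rV[R]_n) : R :=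
  \sum_i (intensity g a i - I 0 i * ln (intensity g a i)).

Lemma J_ML_likelihood (g : 'I_n -> R) (k : 'I_n -> nat) (a : 'rV[R]_2) :
  (forall i, 0 < intensity g a i) ->
  - ln (likelihood g k a) =
  J_ML g a (\row_i (k i)%:R) + \sum_i ln (k i)`!%:R.
Proof.
move=> a0; rewrite /J_ML /likelihood -big_split/=.
have pos i : 0 < expR (- intensity g a i) * intensity g a i ^+ k i / (k i)`!%:R.
  by rewrite divr_gt0 ?mulr_gt0 ?expR_gt0 ?exprn_gt0// ltr0n fact_gt0.
rewrite -[LHS]add0r.
suff [_ ->] : 0 < \prod_i (expR (- intensity g a i) * intensity g a i ^+ k i
                           / (k i)`!%:R) /\
  ln (\prod_i (expR (- intensity g a i) * intensity g a i ^+ k i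
               / (k i)`!%:R)) =
  - \sum_i (intensity g a i - (\row_i0 (k i0)%:R : 'rV[R]_n) 0 i
            * ln (intensity g a i) + ln (k i)`!%:R) by rewrite opprK add0r.
apply: (big_ind2 (fun p s : R => 0 < p /\ ln p = - s)).
- by rewrite ln1 oppr0.
- by move=> p s q u [p0 ps] [q0 qu]; rewrite mulr_gt0// lnM// ps qu opprD.
- move=> i _; split => //; rewrite mxE.
  have f0 : (0 : R) < (k i)`!%:R by rewrite ltr0n fact_gt0.
  rewrite ln_div ?posrE ?mulr_gt0 ?expR_gt0 ?exprn_gt0//.
  rewrite lnM ?posrE ?expR_gt0 ?exprn_gt0// expRK lnXn// mulr_natl.
  by rewrite !opprD !opprK.
Qed.

(* tau(I) is a minimizer of J_ML(., I) over the parameter space whenever one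
   exists. For some data, such as I = 0, the minimum is not attained on the
   open quadrant, and tau(I) is then left unspecified. *)
Definition is_ML_estimator (g : 'I_n -> R) (tau : 'rV[R]_n -> 'rV[R]_2) : Prop :=
  forall I a, is_argmin param_space (J_ML g ^~ I) a ->
    is_argmin param_space (J_ML g ^~ I) (tau I).

(* The second derivatives of tau are required along the half-open segments
   joining the mean Ibar to the points of the support N^n of the Poisson law,
   the endpoint (t = 1) being reached by continuity only. Requiring them at
   t = 1 too would be too much: tau is homogeneous of degree 1, hence in general
   not differentiable at the data I = 0. *)
Definition regular_estimator (tau : 'rV[R]_n -> 'rV[R]_2) (Ibar : 'rV[R]_n) :
    Prop :=
  forall k : 'I_n -> nat, let I : 'rV[R]_n := \row_i (k i)%:R in
    (forall (j : 'I_2) (t : R), 0 <= t < 1 ->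
       C2_near (fun q => tau q 0 j) (segment_point Ibar I t)) /\
    tau (segment_point Ibar I t) @[t --> 1^'-] --> tau I.

End pixel_model.

Section bounds.
Context {d} {T : measurableType d} {R : realType} {n : nat}.
Context (P : probability T R) (tau : 'rV[R]_n -> 'rV[R]_2).
Context (Ibar : 'rV[R]_n) (I : T -> 'rV[R]_n).
Local Open Scope ereal_scope.

Definition remainder (j : 'I_2) (t : R) (w : T) : R :=
  taylor2 (fun q => tau q 0%R j) Ibar t (I w).

Definition linear_part (j : 'I_2) (w : T) : R :=
  (row j (jacobian_col tau Ibar) *m (I w - Ibar)^T)%R 0%R 0%R.

(* A supremum, equal to the maximum over [0, 1] whenever that is attained. *)
Definition max01 (f : R -> \bar R) : \bar R :=
  ereal_sup [set f t | t in `[0%R, 1%R]].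

Definition eps_ML (alpha : 'rV[R]_2) (j : 'I_2) : \bar R :=
  `|(tau Ibar 0 j - alpha 0 j)%R%:E| +
  max01 (fun t => `| 'E_P[remainder j t] |).

Definition max_sqr_remainder (j : 'I_2) : \bar R :=
  max01 (fun t => 'E_P[fun w => (remainder j t w ^+ 2)%R]).

Definition beta_ML (j : 'I_2) : \bar R :=
  max_sqr_remainder j +
  2%:E * max01 (fun t =>
    `| 'E_P[fun w => (linear_part j w * remainder j t w)%R] |).

End bounds.

(* Main.v *)
(** The mean [Ibar] is exactly fitted by [alpha], and the data
    [lam_h (alpha + s u) (1 + s c_h)] with [c] orthogonal to the design are
    fitted by [alpha + s u]; their velocities at [s = 0] span all directions, so
    the derivative of the estimator at [Ibar] is determined without proving that
    minimizers exist for all data near [Ibar].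

    For the moment bounds, the point [t] of the Taylor-Lagrange remainder
    depends on the data, so that it cannot be pulled out of an expectation. But
    every finite combination [sum_m w_m tau (Ibar + t (I_m - Ibar))] is a single
    scalar function of [t], so the remainders [R_m] satisfy
    [sum_m w_m R_m = sum_m w_m e_m^(xi)] with the same [xi] for all [m]. Taking
    for [w] the probabilities of the data (times [1], the linear part, or [R_m]
    itself), truncated to finitely many [m], and letting the truncation go to
    infinity, each expectation involving [R] is bounded by the maximum over [t]
    of the one involving [e^(t)]. *)

Require Import Defs.
From HB Require Import structures.
From mathcomp Require Import all_boot all_order all_algebra.
From mathcomp Require Import all_classical all_reals all_analysis.
From mathcomp Require Import measurable_realfun ring lra.

Set Implicit Arguments.
Unset Strict Implicit.
Unset Printing Implicit Defensive.

Import Order.TTheory GRing.Theory Num.Theory.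
Import numFieldNormedType.Exports.

Local Open Scope classical_set_scope.
Local Open Scope ring_scope.

(** * Taylor expansion along segments *)

(** Rolle's theorem twice: on [h] over [0, 1], then on [h'] between 0 and the point [c] found first.
    At 1 left continuity of [f] suffices, since [xi] is interior. *)
Lemma taylor2_lagrange {R : realType} (f f' f'' : R -> R) :
  (forall t : R, 0 <= t < 1 -> is_derive t (1 : R) f (f' t)) ->
  (forall t : R, 0 <= t < 1 -> is_derive t (1 : R) f' (f'' t)) ->
  f t @[t --> 1^'-] --> f 1 ->
  exists2 xi : R, 0 < xi < 1 & f 1 = f 0 + f' 0 + f'' xi / 2.
Proof.
move=> df ddf f1.
(* [A] is the quadratic coefficient for which [h 0 = h 1]; moreover [h' 0 = 0], which starts the
   second use of Rolle. *)
pose A := f 1 - f 0 - f' 0.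
pose h := fun t => f t - (f' 0 * t + A * t ^+ 2).
pose h' := fun t => f' t - (f' 0 + A * (2 * t)).
have dh (t : R) : 0 <= t < 1 -> is_derive t (1 : R) h (h' t).
  move=> t01; have := df _ t01 => dft.
  rewrite /h /h'; apply: is_derive_eq.
  by rewrite /GRing.scale /=; ring.
have dh' (t : R) : 0 <= t < 1 -> is_derive t (1 : R) h' (f'' t - 2 * A).
  move=> t01; have := ddf _ t01 => ddft.
  rewrite /h'; apply: is_derive_eq.
  by rewrite /GRing.scale /=; ring.
have h0 : h 0 = f 0 by rewrite /h; ring.
have h1 : h 1 = f 0 by rewrite /h /A; ring.
have cont (k k' : R -> R) t : is_derive t (1 :
  R) k (k' t) -> {for t, continuous k}.
  by move=> kt; apply: differentiable_continuous; apply/derivable1_diffP.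
have [c c01 hc] : exists2 c : R, c \in `]0, 1[%R & is_derive c (1 : R) h 0.
  apply: Rolle => //.
  - by move=> t; rewrite in_itv/= => /andP[t0 t1]; have := dh t;
    rewrite (ltW t0) t1 => /(_ isT) [].
  - apply/continuous_within_itvP => //; split.
    + by move=> t; rewrite in_itv/= => /andP[t0 t1]; apply: (cont _ h');
      apply: dh; rewrite (ltW t0).
    + apply: cvg_at_right_filter; apply: (cont _ h'); apply: dh.
      by rewrite lexx ltr01.
    + rewrite /h; apply: cvgB => //.
      apply: cvg_at_left_filter.
      by apply: continuousD; apply: continuousM => //;
        [exact: cst_continuous | exact: cst_continuous | exact:
        exprn_continuous].
  - by rewrite h0 h1.
move: c01; rewrite in_itv/= => /andP[c0 c1].
have h'c : h' c = 0.
  have [_ <-] := dh c ltac:(by rewrite (ltW c0) c1).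
  by have [_ ->] := hc.
have [xi xi01 hxi] : exists2 xi : R, xi \in `]0, c[%R & is_derive xi (1 :
  R) h' 0.
  apply: Rolle => //.
  - move=> t; rewrite in_itv/= => /andP[t0 tc]; have := dh' t.
    by rewrite (ltW t0) (lt_trans tc c1) => /(_ isT) [].
  - apply/continuous_within_itvP => //; split.
    + move=> t; rewrite in_itv/= => /andP[t0 tc].
      apply: (cont _ (fun t => f'' t - 2 * A)); apply: dh'.
      by rewrite (ltW t0) (lt_trans tc).
    + apply: cvg_at_right_filter; apply: (cont _ (fun t => f'' t - 2 * A));
      apply: dh'.
      by rewrite lexx ltr01.
    + apply: cvg_at_left_filter; apply: (cont _ (fun t => f'' t - 2 * A));
      apply: dh'.
      by rewrite (ltW c0).
  - by rewrite h'c /h'; ring.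
move: xi01; rewrite in_itv/= => /andP[xi0 xic].
have xi1 := lt_trans xic c1.
exists xi; first by rewrite xi0.
have [_ E1] := dh' xi ltac:(by rewrite (ltW xi0) xi1).
have [_ E2] := hxi.
have : f'' xi - 2 * A = 0 by rewrite -E1 E2.
by rewrite /A => ?; lra.
Qed.

Lemma is_derive_segment {R : realType} {n : nat} (f : 'rV[R]_n -> R)
    (p q : 'rV[R]_n) (t : R) :
  differentiable f (segment_point p q t) ->
  is_derive t (1 : R) (fun s => f (segment_point p q s))
    (\sum_h partial h f (segment_point p q t) * (q 0 h - p 0 h)).
Proof.
move=> df.
(* The difference quotient along the segment is that of [f] in the direction [q - p]. *)
have E : (fun h : R => h^-1 *: (f (segment_point p q (h *: 1 + t)) -
                        f (segment_point p q t))) =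
  (fun h : R => h^-1 *: (f (h *: (q - p) + segment_point p q t) -
                        f (segment_point p q t))).
  apply/funext => h; congr (_ *: (f _ - _)).
  by rewrite /segment_point -[h *: 1]/(h * 1) mulr1 scalerDl addrCA.
have dd := @diff_derivable _ _ _ _ _ (q - p) df.
split; first by rewrite /derivable E.
have -> : 'D_1 (fun s => f (segment_point p q s)) t =
          'D_(q - p) f (segment_point p q t) by rewrite /derive E.
rewrite deriveE// [X in 'd _ _ X]row_sum_delta linear_sum.
by apply: eq_bigr => h _; rewrite linearZ /partial deriveE// !mxE mulrC.
Qed.

(** The scalar expansion is applied to the weighted sum [phi], not to each term; this is what makes
    [xi] common to all [m]. *)
Lemma taylor2_sum {R : realType} {n N : nat} (f : 'rV[R]_n -> R)
    (p : 'rV[R]_n) (q : 'I_N -> 'rV[R]_n) (w : 'I_N -> R) :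
  (forall m (t : R), 0 <= t < 1 -> C2_near f (segment_point p (q m) t)) ->
  (forall m, f (segment_point p (q m) t) @[t --> 1^'-] --> f (q m)) ->
  exists2 xi : R, 0 < xi < 1 &
    \sum_m w m * (f (q m) - f p - \sum_h partial h f p * (q m 0 h - p 0 h)) =
    \sum_m w m * taylor2 f p xi (q m).
Proof.
move=> fC2 f1.
have s0 m : segment_point p (q m) 0 = p by rewrite /segment_point scale0r addr0.
have s1 m : segment_point p (q m) 1 =
  q m by rewrite /segment_point scale1r addrC subrK.
pose phi t := \sum_m w m * f (segment_point p (q m) t).
pose phi' t := \sum_m w m * \sum_h partial h f (segment_point p (q m) t) * (q m
  0 h - p 0 h).
pose phi'' t := \sum_m w m * \sum_h
  (\sum_i partial i (partial h f) (segment_point p (q m) t) * (q m 0 i - p 0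
    i)) * (q m 0 h - p 0 h).
have [] := @taylor2_lagrange _ phi phi' phi''.
- move=> t t01; rewrite /phi /phi'.
  have D m : is_derive t (1 : R) (fun s => w m *: f (segment_point p (q m) s))
     (w m *: \sum_h partial h f (segment_point p (q m) t) * (q m 0 h - p 0 h)).
    apply: is_deriveZ; apply: is_derive_segment.
    by have /nbhs_singleton[] := fC2 m t t01.
  have := is_derive_sum D.
  by rewrite (_ : \sum_i _ = phi)//; apply/funext => s; rewrite fct_sumE.
- move=> t t01; rewrite /phi' /phi''.
  have D m : is_derive t (1 : R)
     (fun s => w m *: \sum_h (q m 0 h - p 0 h) *:
       partial h f (segment_point p (q m) s))
     (w m *: \sum_h (q m 0 h - p 0 h) *: 
       \sum_i partial i (partial h f) (segment_point p (q m) t) * (q m 0 i - p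
         0 i)).
    apply: is_deriveZ.
    have D2 h : is_derive t (1 : R) (fun s =>
      (q m 0 h - p 0 h) *: partial h f (segment_point p (q m) s))
      ((q m 0 h - p 0 h) *:
       \sum_i partial i (partial h f) (segment_point p (q m) t) * (q m 0 i - p
         0 i)).
      apply: is_deriveZ; apply: (is_derive_segment (f := partial h f)).
      by have /nbhs_singleton[_ /(_ h)] := fC2 m t t01.
    have := is_derive_sum D2.
    by rewrite (_ : \sum_i _ = (fun s =>
      \sum_h (q m 0 h - p 0 h) *: partial h f (segment_point p (q m) s)))//;
      apply/funext => s; rewrite fct_sumE.
  have := is_derive_sum D.
  rewrite (_ : \sum_i _ = phi').
    by under eq_bigr do [rewrite /GRing.scale/=;
      under eq_bigr do rewrite mulrC].
  apply/funext => s; rewrite fct_sumE; apply: eq_bigr => m _; congr (_ * _).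
  by apply: eq_bigr => h _; rewrite /GRing.scale/= mulrC.
- have -> : phi 1 = \sum_m w m * f (q m) by apply: eq_bigr => m _; rewrite s1.
  rewrite /phi.
  apply: cvg_big => [|m _]; last by apply: cvgM; [exact: cvg_cst|exact: f1].
  exact: add_continuous.
- move=> xi xi01 E; exists xi => //; move: E.
  rewrite /phi /phi' /phi''.
  under eq_bigr do rewrite s1.
  under [X in X + _ + _]eq_bigr do rewrite s0.
  under [X in _ + X + _]eq_bigr do [under eq_bigr do rewrite s0].
  move=> E.
  under eq_bigr do rewrite !mulrBr.
  have K (a b c : R) : a + b + c - a - b = c by ring.
  rewrite !big_split/= !sumrN E K mulr_suml; apply: eq_bigr => m _.
  rewrite /taylor2 exchange_big/= mulrC mulrCA; congr (_ * (_ * _)).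
  apply: eq_bigr => h _; rewrite mulr_suml; apply: eq_bigr => i _.
  by [].
Qed.

(** * The Poisson log-likelihood and its minimizers *)

(** Reduces a directional derivative to a derivative at 0 of a function of one real variable. *)
Lemma is_derive_line {R : realType} {m : nat} (f : 'rV[R]_m -> R)
    (a v : 'rV[R]_m) (l : R) :
  is_derive (0 : R) (1 : R) (fun h => f (h *: v + a)) l -> is_derive a v f l.
Proof.
have E : (fun h : R => h^-1 *: (f (h *: v + a) - f a)) =
    (fun h : R => h^-1 *: (f ((h *: (1 : R) + 0) *: v + a) - f (0 *: v + a))).
  apply/funext => h.
  by rewrite -[h *: 1]/(h * 1) mulr1 addr0 scale0r add0r.
move=> [D <-]; split; [rewrite /derivable /= E;
  exact: D | by rewrite /derive /= E].
Qed.

Lemma is_derive_ln_affine {R : realType} (c b : R) : 0 < b ->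
  is_derive (0 : R) (1 : R) (fun h => ln (h * c + b)) (c / b).
Proof.
move=> b0.
have [d1 e1] : is_derive (0 : R) (1 : R) (fun h => h * c + b) c.
  by apply: is_derive_eq; rewrite /GRing.scale/=; ring.
have L0 : 0 < 0 * c + b by rewrite mul0r add0r.
have [d2 e2] := is_derive1_ln L0.
split.
  apply/derivable1_diffP.
  change (differentiable (@ln R \o (fun h : R => h * c + b)) 0).
  by apply: differentiable_comp; apply/derivable1_diffP.
rewrite -derive1E (@derive1_comp _ (fun h : R => h * c + b) (@ln R))//.
by rewrite !derive1E e1 e2 mul0r add0r mulrC.
Qed.

(** * Derivatives of the negative log-likelihood *)

Section log_likelihood_calculus.
Context {R : realType} {n : nat} (g : 'I_n -> R).
Implicit Types (a v : 'rV[R]_2) (I : 'rV[R]_n).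

Lemma intensityD a v i : intensity g (a + v) i =
  intensity g a i + intensity g v i.
Proof. by rewrite /intensity !mxE; ring. Qed.

Lemma intensityZ (t : R) v i : intensity g (t *: v) i = t * intensity g v i.
Proof. by rewrite /intensity !mxE; ring. Qed.

(** The intensity is linear in the parameters. [intensity g (delta_mx 0 k) i] is the entry of the
    design matrix for parameter [k]: [g i] for the flux, 1 for the background. This form treats both
    parameters at once. *)
Lemma intensity_sum a i :
  intensity g a i = \sum_k a 0 k * intensity g (delta_mx 0 k) i.
Proof.
rewrite !big_ord_recl big_ord0 /intensity !mxE.
by rewrite (_ : lift ord0 ord0 = 1); [rewrite /=; ring | exact: val_inj].
Qed.

Lemma is_derive_intensity a v i :
  is_derive a v (fun b => intensity g b i) (intensity g v i).
Proof.
apply: is_derive_line.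
under eq_fun do rewrite intensityD intensityZ.
by apply: is_derive_eq; rewrite /GRing.scale/=; ring.
Qed.

Lemma near_intensity_gt0 a : (forall i, 0 < intensity g a i) ->
  \forall b \near a, forall i, 0 < intensity g b i.
Proof.
move=> a0; near=> b => i; move: i; near: b; apply: filter_forall => /= i.
have : intensity g b i @[b --> a] --> intensity g a i.
  apply: (@cvgD _ _ _ (nbhs a) _ (fun b : 'rV[R]_2 =>
    b 0 0 * g i) (fun b : 'rV[R]_2 => b 0 1)).
    apply: (@cvgM _ _ (nbhs a) _ (fun b : 'rV[R]_2 => b 0 0) (cst (g i))).
      exact: coord_continuous.
    exact: cvg_cst.
  exact: coord_continuous.
by move=> /(_ _ (lt_nbhsr (a0 i))).
Unshelve. all: by end_near. Qed.

Lemma is_derive_J_ML a v I : (forall i, 0 < intensity g a i) ->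
  is_derive a v (J_ML g ^~ I)
    (\sum_i (1 - I 0 i / intensity g a i) * intensity g v i).
Proof.
move=> a0; rewrite /J_ML.
have D i : is_derive a v
    (fun b => intensity g b i - I 0 i * ln (intensity g b i))
    ((1 - I 0 i / intensity g a i) * intensity g v i).
  apply: is_derive_line.
  have E : (fun h : R => intensity g (h *:
    v + a) i - I 0 i * ln (intensity g (h *: v + a) i))
     = (fun h => (h * intensity g v i + intensity g a i) - I 0 i *:
       ln (h * intensity g v i + intensity g a i)).
    by apply/funext => h; rewrite intensityD intensityZ.
  rewrite E.
  have Dln := is_derive_ln_affine (intensity g v i) (a0 i).
  by apply: is_derive_eq; rewrite /GRing.scale/=; ring.
have -> : (fun b => \sum_i (intensity g b i - I 0 i * ln (intensity g b i))) =
   \sum_i (fun b => (intensity g b i - I 0 i * ln (intensity g b i))).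
  by apply/funext => b; rewrite fct_sumE.
exact: is_derive_sum.
Qed.

Lemma nabla20_J_MLE a I k l : (forall i, 0 < intensity g a i) ->
  nabla20 (J_ML g) a I k l =
  \sum_i I 0 i / intensity g a i ^+ 2 * intensity g (delta_mx 0 k) i
          * intensity g (delta_mx 0 l) i.
Proof.
move=> a0; rewrite mxE /partial.
(* The gradient formula requires positive intensities; these persist near [a], which is enough to
   differentiate once more. *)
rewrite (@near_eq_derive _ _ _ _ (fun b => \sum_i (1 - I 0 i / intensity g b i)
     * intensity g (delta_mx 0 l) i)); last first.
  near=> b; apply: (derive_val (is_derive := is_derive_J_ML _ _ _)).
  by near: b; exact: near_intensity_gt0.
have D i : is_derive a (delta_mx 0 k : 'rV[R]_2)
    (fun b => (1 - I 0 i / intensity g b i) * intensity g (delta_mx 0 l) i)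
    (I 0 i / intensity g a i ^+ 2 * intensity g (delta_mx 0 k) i
          * intensity g (delta_mx 0 l) i).
  have [d1 e1] := is_derive_intensity a (delta_mx 0 k) i.
  have an0 : intensity g a i != 0 by rewrite gt_eqF.
  have DV : is_derive a (delta_mx 0 k : 'rV[R]_2) (fun b =>
    (intensity g b i)^-1)
      (- (intensity g a i) ^- 2 *: intensity g (delta_mx 0 k) i).
    split; first exact: derivableV.
    by rewrite deriveV// e1.
  have -> : (fun b => (1 - I 0 i / intensity g b i) * intensity g (delta_mx 0
    l) i) =
     (fun b => intensity g (delta_mx 0 l) i *: (1 - I 0 i *:
       (intensity g b i)^-1)).
    by apply/funext => b; rewrite mulrC.
  by apply: is_derive_eq; rewrite /GRing.scale/=; ring.
have := is_derive_sum D.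
rewrite (_ : \sum_i _ = (fun b => \sum_i (1 - I 0 i / intensity g b i)
     * intensity g (delta_mx 0 l) i)) => [[_ //]|].
by apply/funext => b; rewrite fct_sumE.
Unshelve. all: by end_near. Qed.

Lemma nabla11_J_MLE a I k i : (forall i, 0 < intensity g a i) ->
  nabla11 (J_ML g) a I k i = - intensity g (delta_mx 0 k) i / intensity g a i.
Proof.
move=> a0; rewrite mxE.
(* [J_ML] is affine in the data, so this holds for every [b], whatever the sign of its
   intensities. *)
have E b : partial i (J_ML g b) I = - ln (intensity g b i).
  apply: (derive_val (is_derive := is_derive_line _)).
  rewrite /J_ML.
  have D h : is_derive (0 : R) (1 : R) (fun t : R => intensity g b h -
       (t * (h == i)%:R + I 0 h) * ln (intensity g b h)) (- ((h == i)%:R * ln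
         (intensity g b h))).
    by apply: is_derive_eq; rewrite /GRing.scale/=; ring.
  have := is_derive_sum D.
  rewrite (_ : \sum_h _ = (fun t : R => \sum_i0
    (intensity g b i0 - (t *: delta_mx 0 i + I) 0 i0 * ln (intensity g b i0)))).
    rewrite (bigD1 i)//= big1 ?addr0 ?eqxx ?mul1r// => h /negbTE ->.
    by rewrite mul0r oppr0.
  by apply/funext => t; rewrite fct_sumE; apply: eq_bigr => h _; rewrite !mxE/=.
under eq_fun do rewrite E.
rewrite /partial.
apply: (derive_val (is_derive := is_derive_line _)).
rewrite (_ : (fun h : R => _) = (fun h : R =>
  - ln (h * intensity g (delta_mx 0 k) i + intensity g a i))); last first.
  by apply/funext => h; rewrite intensityD intensityZ.
have Dln := is_derive_ln_affine (intensity g (delta_mx 0 k) i) (a0 i).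
by apply: is_derive_eq; rewrite mulNr.
Qed.
End log_likelihood_calculus.

Lemma ln_leB1 {R : realType} (x : R) : 0 < x -> ln x <= x - 1.
Proof.
by move=> x0; rewrite -{1}(subrKC 1 x) le_ln1Dx// ltrBrDr addNr.
Qed.

(** The equality case of [ln_leB1], from the strict inequality [1 + y < expR y] for nonzero [y]. It
    is the source of uniqueness below. *)
Lemma ln_eqB1 {R : realType} (x : R) : 0 < x -> ln x = x - 1 -> x = 1.
Proof.
move=> x0 E; apply: contrapT => /eqP x1.
have := @expR_gt1Dx R (x - 1).
by rewrite subr_eq0 => /(_ x1); rewrite -E lnK// E subrKC ltxx.
Qed.

Lemma differentiable_rV {R : realType} {V : normedModType R} {m : nat}
    (f : V -> 'rV[R]_m) (p : V) :
  (forall j, differentiable (fun q => f q 0 j) p) -> differentiable f p.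
Proof.
move=> df.
have -> : f = \sum_j (fun q => f q 0 j *: (delta_mx 0 j : 'rV[R]_m)).
  by apply/funext => q; rewrite fct_sumE -row_sum_delta.
by apply: differentiable_sum => j; exact: differentiableZl.
Qed.

Lemma jacobian_colE {R : realType} {m n : nat} (f : 'rV[R]_n -> 'rV[R]_m)
    (p : 'rV[R]_n) (j : 'I_m) (i : 'I_n) :
  (forall j, differentiable (fun q => f q 0 j) p) ->
  jacobian_col f p j i = partial i (fun q => f q 0 j) p.
Proof.
move=> df; have dfp := differentiable_rV df.
rewrite /jacobian_col /jacobian !mxE -deriveE// /partial.
by rewrite derive_mx ?mxE//; exact: diff_derivable.
Qed.

(** * Critical points, minimizers and the derivative of the estimator *)

Section maximum_likelihood.
Context {R : realType} {n : nat} (g : 'I_n -> R) (g0 : forall i, 0 <= g i).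
Implicit Types (a b : 'rV[R]_2) (I : 'rV[R]_n).

Lemma param_space_intensity_gt0 a :
  param_space a -> forall i, 0 < intensity g a i.
Proof.
by move=> [a0 a1] i; rewrite /intensity ltr_wpDl// mulr_ge0// ltW.
Qed.

(** The score equations: the gradient of [J_ML g ^~ I] at [a], in the closed form of
    [is_derive_J_ML], vanishes. *)
Definition critical I a := forall k : 'I_2,
  \sum_i (1 - I 0 i / intensity g a i) * intensity g (delta_mx 0 k) i = 0.

(* At a critical point [a] the linear part of [J b - J a] vanishes, and what is
   left is a sum of terms [r - 1 - ln r]. *)
Lemma J_ML_critical I a b : param_space a -> param_space b -> critical I a ->
  J_ML g b I - J_ML g a I =
  \sum_i I 0 i * (intensity g b i / intensity g a i - 1
                  - ln (intensity g b i / intensity g a i)).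
Proof.
move=> pa pb Ia.
have a0 := param_space_intensity_gt0 pa.
have b0 := param_space_intensity_gt0 pb.
(* By linearity of the intensity, the score vanishes in every direction. Its value in the direction
   [b - a] is then added as a zero, which makes the identity hold term by term. *)
have Z v : \sum_i (1 - I 0 i / intensity g a i) * intensity g v i = 0.
  under eq_bigr do rewrite (intensity_sum g v) mulr_sumr.
  rewrite exchange_big/= big1// => k _.
  under eq_bigr do rewrite mulrCA.
  by rewrite -mulr_sumr Ia mulr0.
rewrite -[RHS]addr0 -[X in _ = _ + X](Z (b - a)) -[RHS]big_split /J_ML -sumrB/=.
apply: eq_bigr => i _.
have -> : intensity g (b - a) i = intensity g b i - intensity g a i.
  by rewrite -scaleN1r intensityD intensityZ mulN1r.
rewrite ln_div ?posrE//.
by field; rewrite gt_eqF.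
Qed.

(** Every term [r - 1 - ln r] of the preceding identity is nonnegative. Minimizers are produced in
    this way only, from explicit critical points. *)
Lemma critical_argmin I a : (forall i, 0 <= I 0 i) -> param_space a ->
  critical I a -> is_argmin param_space (J_ML g ^~ I) a.
Proof.
move=> I0 pa Ia; split=> // b pb; rewrite -subr_ge0 J_ML_critical//.
apply: sumr_ge0 => i _; rewrite mulr_ge0// subr_ge0 ln_leB1//.
by rewrite divr_gt0// param_space_intensity_gt0.
Qed.

(** Both points being minimizers, the sum of nonnegative terms is zero; with positive data each
    ratio of intensities must then be 1. Only the intensities are identified here, not the
    parameters. *)
Lemma argmin_critical_intensity I a b : (forall i, 0 < I 0 i) ->
  param_space a -> critical I a -> is_argmin param_space (J_ML g ^~ I) b ->
  forall i, intensity g b i = intensity g a i.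
Proof.
move=> I0 pa Ia [pb bmin] i.
have a0 := param_space_intensity_gt0 pa.
have b0 := param_space_intensity_gt0 pb.
have r0 j : 0 < intensity g b j / intensity g a j by rewrite divr_gt0.
have /eqP : \sum_i I 0 i * (intensity g b i / intensity g a i - 1
                  - ln (intensity g b i / intensity g a i)) = 0.
  apply/eqP; rewrite eq_le; apply/andP; split.
    by rewrite -J_ML_critical// subr_le0 bmin.
  apply: sumr_ge0 => j _; rewrite mulr_ge0// ?subr_ge0 ?ln_leB1//.
  exact: ltW.
rewrite psumr_eq0; last first.
  by move=> j _; rewrite mulr_ge0// ?subr_ge0 ?ln_leB1// ltW.
move=> /allP/(_ i); rewrite mem_index_enum => /(_ isT)/=.
rewrite mulf_eq0 gt_eqF//= subr_eq0 => /eqP/esym/(ln_eqB1 (r0 i)).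
by move=> /(congr1 ( *%R^~ (intensity g a i))); rewrite mul1r divfK// gt_eqF.
Qed.

Lemma critical_mean a (I := \row_i intensity g a i) :
  param_space a -> critical I a.
Proof.
move=> pa k; rewrite big1// => i _.
by rewrite mxE divff ?subrr ?mul0r// gt_eqF// param_space_intensity_gt0.
Qed.

Variables (tau : 'rV[R]_n -> 'rV[R]_2) (alpha : 'rV[R]_2).
Let lam := intensity g alpha.
Let Ibar : 'rV[R]_n := \row_i lam i.
Let H := nabla20 (J_ML g) (tau Ibar) Ibar.
Hypothesis pos_alpha : param_space alpha.
Hypothesis tau_ML : is_ML_estimator g tau.

Let lam0 i : 0 < lam i. Proof. exact: param_space_intensity_gt0. Qed.

(** [is_ML_estimator] speaks only of data for which a minimizer exists; at [Ibar] the true parameter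
    is one. *)
Lemma ML_mean_argmin : is_argmin param_space (J_ML g ^~ Ibar) (tau Ibar).
Proof.
apply: (@tau_ML _ alpha); apply: critical_argmin => //.
  by move=> i; rewrite mxE ltW.
exact: critical_mean.
Qed.

Lemma ML_mean_intensity i : intensity g (tau Ibar) i = lam i.
Proof.
apply: (@argmin_critical_intensity Ibar) => //.
- by move=> j; rewrite mxE.
- exact: critical_mean.
- exact: ML_mean_argmin.
Qed.

Let ML_mean_intensity_gt0 i : 0 < intensity g (tau Ibar) i.
Proof. by rewrite ML_mean_intensity. Qed.

Lemma nabla20_ML_mean k l : H k l =
  \sum_i intensity g (delta_mx 0 k) i * intensity g (delta_mx 0 l) i / lam i.
Proof.
rewrite /H nabla20_J_MLE//; apply: eq_bigr => i _.
rewrite ML_mean_intensity mxE; field.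
by rewrite gt_eqF.
Qed.

Lemma nabla11_ML_mean k i : nabla11 (J_ML g) (tau Ibar) Ibar k i =
  - intensity g (delta_mx 0 k) i / lam i.
Proof. by rewrite nabla11_J_MLE// ML_mean_intensity. Qed.

Hypothesis unitH : H \in unitmx.

(** Identifiability: [H] is the Gram matrix of the design with weights [1 / lam], so it annihilates
    any direction whose intensities all vanish, and invertibility excludes a nonzero one. *)
Lemma intensity_inj a b : (forall i, intensity g a i = intensity g b i) -> a =
  b.
Proof.
move=> ab; apply/eqP; rewrite -subr_eq0; apply/eqP.
set v := a - b.
have v0 i : intensity g v i = 0.
  by rewrite /v -scaleN1r intensityD intensityZ ab mulN1r subrr.
have vH : v *m H = 0.
  apply/rowP => l; rewrite !mxE.
  under eq_bigr do rewrite nabla20_ML_mean mulr_sumr.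
  rewrite exchange_big/= big1// => i _.
  under eq_bigr do rewrite -mulrA mulrA.
  by rewrite -mulr_suml -intensity_sum v0 mul0r.
by rewrite -(mulmxK unitH v) vH mul0mx.
Qed.

(** With identifiability, [tau] is known explicitly at all positive data for which a critical point
    can be exhibited. *)
Lemma ML_unique I a : (forall i, 0 < I 0 i) -> param_space a -> critical I a ->
  tau I = a.
Proof.
move=> I0 pa Ia; apply: intensity_inj.
apply: (@argmin_critical_intensity I) => //.
apply: (@tau_ML _ a); apply: critical_argmin => // i.
exact: ltW.
Qed.

(** A curve [gam] leaves [Ibar] with velocity [delta_mx 0 i], and [tau (gam s) = alpha + s *: u^T]
    for small [s]. Comparing derivatives at 0 gives the partial derivative. *)
Lemma ML_partial (u : 'cV[R]_2) (i : 'I_n) (j : 'I_2) :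
  H *m u = - col i (nabla11 (J_ML g) (tau Ibar) Ibar) ->
  differentiable (fun q => tau q 0 j) Ibar ->
  partial i (fun q => tau q 0 j) Ibar = u j 0.
Proof.
move=> Hu dtau.
(* [c] solves [m h + lam h * c h = (h == i)], so that the product in [gamE] has velocity
   [delta_mx 0 i]; [z] is its second-order coefficient. *)
pose m h := intensity g u^T h.
pose c h := ((h == i)%:R - m h) / lam h.
pose z : 'rV[R]_n := \row_h (m h * c h).
pose gam (s : R) : 'rV[R]_n := (Ibar + s *: delta_mx 0 i) + s ^+ 2 *: z.
have lamn0 h : lam h != 0 by rewrite gt_eqF.
have gamE s h : gam s 0 h = intensity g (alpha + s *: u^T) h * (1 + s * c h).
  rewrite !mxE eqxx/= intensityD intensityZ -/(m h) -/(lam h) /c.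
  by field.
(* Orthogonality of [c] to the design is the linear system [Hu] rewritten. *)
have cG k : \sum_h c h * intensity g (delta_mx 0 k) h = 0.
  have /(congr1 (fun M : 'cV[R]_2 => M k 0)) := Hu.
  rewrite [LHS]mxE [RHS]mxE [X in - X]mxE nabla11_ML_mean mulNr opprK => E.
  have : \sum_h m h / lam h * intensity g (delta_mx 0 k) h =
    intensity g (delta_mx 0 k) i / lam i.
    rewrite -E; under [RHS]eq_bigr do rewrite nabla20_ML_mean mulr_suml.
    rewrite exchange_big/=; apply: eq_bigr => h _.
    rewrite /m intensity_sum !mulr_suml; apply: eq_bigr => l _.
    by rewrite !mxE; ring.
  move=> E2; rewrite /c.
  under eq_bigr do rewrite mulrBl mulrBl.
  rewrite sumrB E2 (bigD1 i)//= big1 ?addr0 ?eqxx ?mul1r.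
    by rewrite mulrC subrr.
  by move=> h /negbTE ->; rewrite !mul0r.
have near_gt0 (a b : R) : 0 < a -> \forall s \near (0 : R), 0 < a + s * b.
  move=> a0; have : a + s * b @[s --> (0 : R)] --> a + 0 * b.
    by apply: cvgD; [exact: cvg_cst | exact: cvgMr_tmp].
  by rewrite mul0r addr0 => /(_ _ (lt_nbhsr a0)).
have tauE : \forall s \near (0 : R), tau (gam s) 0 j = u j 0 * s + alpha 0 j.
  have [al0 al1] := pos_alpha.
  near=> s.
  have ps : param_space (alpha + s *: u^T).
    by split; rewrite !mxE; near: s; exact: near_gt0.
  have cs h : 0 < 1 + s * c h.
    by move: h; near: s; apply: filter_forall => h; exact: near_gt0.
  rewrite (@ML_unique _ (alpha + s *: u^T)) ?mxE//.
  - by rewrite addrC mulrC.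
  - by move=> h; rewrite gamE mulr_gt0// param_space_intensity_gt0.
  (* At [gam s] each factor of the score equals [- s * c h], so the score equations reduce to
     [cG]. *)
  move=> k; rewrite -[RHS](mulr0 (- s)) -[X in _ = _ * X](cG k) mulr_sumr;
    apply: eq_bigr => h _.
  rewrite gamE; field.
  by rewrite gt_eqF// param_space_intensity_gt0.
have gam0 : gam 0 = Ibar by rewrite /gam scale0r addr0 expr0n scale0r addr0.
have dgam : is_derive (0 : R) (1 : R) gam (delta_mx 0 i).
  have Dz : is_derive (0 : R) (1 : R) (fun s : R => s ^+ 2 *: z) 0.
    have dX : differentiable (fun s : R => s ^+ 2) 0.
      by apply/derivable1_diffP.
    split; first by apply/derivable1_diffP; exact: differentiableZl.
    rewrite deriveE; last exact: differentiableZl.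
    rewrite diffZl//= -deriveE//.
    have [_ ->] : is_derive (0 : R) (1 : R) (fun s : R => s ^+ 2) 0.
      by apply: is_derive_eq; rewrite /GRing.scale/=; ring.
    by rewrite scale0r.
  have Dd : is_derive (0 : R) (1 : R) (fun s : R =>
    s *: (delta_mx 0 i : 'rV[R]_n)) (delta_mx 0 i).
    have dX : differentiable (@id R) 0 by apply/derivable1_diffP.
    split; first by apply/derivable1_diffP;
      exact: (differentiableZl (k := @id R)).
    rewrite deriveE; last exact: (differentiableZl (k := @id R)).
    by rewrite (diffZl (k := @id R))//= -deriveE// derive_id scale1r.
  by apply: is_derive_eq; rewrite add0r addr0.
have [dg eg] := dgam.
have /derivable1_diffP Dg := dg.
have E1 : 'D_1 (fun s => tau (gam s) 0 j) (0 : R) = u j 0.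
  rewrite (near_eq_derive _ tauE).
  have [_ ->//] : is_derive (0 : R) (1 : R) (fun s =>
    u j 0 * s + alpha 0 j) (u j 0).
  by apply: is_derive_eq; rewrite /GRing.scale/=; ring.
rewrite -E1 /partial deriveE//.
have dt : differentiable (fun q => tau q 0 j) (gam 0) by rewrite gam0.
rewrite deriveE; last by apply: (differentiable_comp (f := gam) (g := fun q =>
  tau q 0 j)).
by rewrite (diff_comp (f := gam) (g := fun q =>
  tau q 0 j))//= -[X in _ = 'd _ _ X]deriveE// eg gam0.
Unshelve. all: by end_near. Qed.


Lemma ML_jacobian : (forall j, differentiable (fun q => tau q 0 j) Ibar) ->
  jacobian_col tau Ibar = - invmx H *m nabla11 (J_ML g) (tau Ibar) Ibar.
Proof.
move=> dtau; apply/matrixP => j i; rewrite jacobian_colE//.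
(* The solution of the linear system required by [ML_partial]. *)
pose u := - invmx H *m col i (nabla11 (J_ML g) (tau Ibar) Ibar).
rewrite (@ML_partial u)//; last by rewrite /u mulNmx mulmxN mulKVmx.
by rewrite /u colE mulmxA -colE mxE.
Qed.

Lemma intensity_delta0 i : intensity g (delta_mx 0 0) i = g i.
Proof. by rewrite /intensity !mxE/= mul1r addr0. Qed.

Lemma intensity_delta1 i : intensity g (delta_mx 0 1) i = 1.
Proof. by rewrite /intensity !mxE/= mul0r add0r. Qed.

Lemma nabla11_ML_mean_mx : nabla11 (J_ML g) (tau Ibar) Ibar =
  col_mx (\row_i (- g i / lam i)) (\row_i (- 1 / lam i)) :> 'M[R]_(1 + 1, n).
Proof.
apply/matrixP => k i; rewrite nabla11_ML_mean mxE.
case: splitP => k0; rewrite ord1 => kE; rewrite mxE.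
  by have -> : k = 0; [exact: val_inj | rewrite intensity_delta0].
by have -> : k = 1; [exact: val_inj | rewrite intensity_delta1].
Qed.

Lemma nabla20_ML_mean_mx : H =
  block_mx (\sum_i g i ^+ 2 / lam i)%:M (\sum_i g i / lam i)%:M
           (\sum_i g i / lam i)%:M      (\sum_i 1 / lam i)%:M
  :> 'M[R]_(1 + 1, 1 + 1).
Proof.
apply/matrixP => k l; rewrite nabla20_ML_mean mxE.
case: splitP => k0; rewrite ord1 => kE; rewrite mxE;
  case: splitP => l0; rewrite ord1 => lE; rewrite mxE eqxx mulr1n.
- by have [-> ->] : k = 0 /\ l = 0; [split; exact: val_inj |];
    apply: eq_bigr => i _; rewrite intensity_delta0 expr2.
- by have [-> ->] : k = 0 /\ l = 1; [split; exact: val_inj |];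
    apply: eq_bigr => i _; rewrite intensity_delta0 intensity_delta1 mulr1.
- by have [-> ->] : k = 1 /\ l = 0; [split; exact: val_inj |];
    apply: eq_bigr => i _; rewrite intensity_delta0 intensity_delta1 mul1r.
- by have [-> ->] : k = 1 /\ l = 1; [split; exact: val_inj |];
    apply: eq_bigr => i _; rewrite intensity_delta1 mul1r.
Qed.

End maximum_likelihood.

(** * Expectations of functions of counts *)

Section law_of_counts.
Context {d} {T : measurableType d} {R : realType} (P : probability T R).
Implicit Types (Z : {mfun T >-> nat}) (F G : nat -> R).

Lemma measurable_comp_nat Z F : measurable_fun [set: T] (fun w => F (Z w)).
Proof.
by apply: (measurableT_comp (f := F)) => // _ A mA; rewrite setTI.
Qed.

Definition atom Z (m : nat) : R := fine (P (Z @^-1` [set m])).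

Lemma measurable_atom Z m : measurable (Z @^-1` [set m]).
Proof. exact: measurable_funPTI. Qed.

Lemma atomE Z m : (atom Z m)%:E = P (Z @^-1` [set m]).
Proof. by rewrite /atom fineK// fin_num_measure//; exact: measurable_atom. Qed.

Lemma atom_ge0 Z m : 0 <= atom Z m.
Proof. by rewrite fine_ge0. Qed.

Lemma Lfun1_bounded (X : T -> R) (M : R) : measurable_fun [set: T] X ->
  (forall w, `|X w| <= M) -> X \in Lfun P 1.
Proof.
move=> mX XM; apply/Lfun1_integrable.
apply: (@le_integrable _ _ _ P _ measurableT _ (EFin \o cst M)).
- exact/measurable_EFinP.
- by move=> w _; rewrite lee_fin (le_trans (XM w))// ler_norm.
- exact: finite_measure_integrable_cst.
Qed.

Lemma Lfun2_sqr (X : T -> R) : measurable_fun [set: T] X ->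
  ('E_P[fun w => (X w ^+ 2)%R] < +oo)%E -> X \in Lfun P 2%:E.
Proof.
move=> mX X2; rewrite inE; apply/andP; split; rewrite inE//=.
rewrite /finite_norm unlock /Lnorm poweR_lty//.
move: X2; rewrite unlock; apply: le_lt_trans.
rewrite le_eqVlt; apply/orP; left; apply/eqP.
by apply: eq_integral => w _; rewrite /= powR_mulrn// real_normK// num_real.
Qed.

(** Truncation leaves finitely many atoms, so no integrability of [F] is involved; the atoms are
    adjoined one at a time. *)
Lemma expectation_truncated Z F N :
  ('E_P[fun w => if (Z w < N)%N then F (Z w) else 0%R] =
   (\sum_(m < N) F m * atom Z m)%R%:E)%E.
Proof.
elim: N => [|N IH].
  by rewrite big_ord0 -(expectation_cst P 0).
rewrite big_ord_recr/= EFinD -IH EFinM atomE -expectation_indic//;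
  last exact: measurable_atom.
have L1 : (\1_(Z @^-1` [set N]) : T -> R) \in Lfun P 1.
  apply: (@Lfun1_bounded _ 1).
    by apply: measurable_indic; exact: measurable_atom.
  by move=> w; rewrite indicE; case: (_ \in _); rewrite ?normr1 ?normr0.
rewrite -expectationZl// -expectationD//; first last.
- exact: Lfun_scale.
- apply: (@Lfun1_bounded _ (\sum_(m < N) `|F m|)).
    exact: (measurable_comp_nat Z (fun m => if (m < N)%N then F m else 0)).
  move=> w; case: ifPn => ZN; last by rewrite normr0 sumr_ge0.
  by rewrite (bigD1 (Ordinal ZN))//= lerDl sumr_ge0.
congr expectation; apply/funext => w /=; rewrite indicE ltnS.
case: ltngtP => [ZN|ZN|ZN].
- by rewrite memNset ?mul0r ?addr0//= => E; rewrite E ltnn in ZN.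
- by rewrite memNset ?mul0r ?addr0//= => E; rewrite E ltnn in ZN.
- by rewrite (mem_set (A := Z @^-1` [set N]) ZN) ZN mul1r add0r.
Qed.

(** Dominated convergence of the truncations, with [|F (Z w)|] as dominating function. *)
Lemma cvg_expectation_nat Z F : (fun w => F (Z w)) \in Lfun P 1 ->
  \sum_(m < N) F m * atom Z m @[N --> \oo] --> fine ('E_P[fun w => F (Z w)])%E.
Proof.
move=> LF; have fE := expectation_fin_num LF.
have -> : (fun N => \sum_(m < N) F m * atom Z m) =
    fine \o (fun N => 'E_P[fun w => if (Z w < N)%N then F (Z w) else 0%R])%E.
  by apply/funext => N /=; rewrite expectation_truncated.
apply: fine_cvg; rewrite fineK//.
rewrite unlock; apply: (@dominated_cvg _ _ _ P _ measurableT _ _ (fun w =>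
  `|F (Z w)|%:E)).
- move=> N; apply/measurable_EFinP.
  exact: (measurable_comp_nat Z (fun m => if (m < N)%N then F m else 0)).
- move=> w _; apply: cvg_near_cst; near=> N.
  by rewrite ifT//; near: N; exists (Z w).+1.
- by move=> w _.
- by move/Lfun1_integrable/integrable_norm : LF.
- by move=> N w _; rewrite lee_fin; case: ifPn => //; rewrite normr0.
Unshelve. all: by end_near. Qed.

Lemma expectation_nat_ge_sum Z F N : (forall m, 0 <= F m) ->
  (fun w => F (Z w)) \in Lfun P 1 ->
  \sum_(m < N) F m * atom Z m <= fine ('E_P[fun w => F (Z w)])%E.
Proof.
move=> F0 LF; have cF := cvg_expectation_nat LF.
rewrite -(cvg_lim _ cF)//; apply: (@nondecreasing_cvgn_le _ (fun N =>
  \sum_(m < N) F m * atom Z m)).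
  apply/nondecreasing_seqP => k; rewrite big_ord_recr/= lerDl.
  by rewrite mulr_ge0// atom_ge0.
by apply/cvg_ex; eexists; exact: cF.
Qed.

Lemma ge0_integral_partition Z (f : T -> \bar R) : measurable_fun [set: T] f ->
  (forall w, 0 <= f w)%E ->
  (\int[P]_w f w = \sum_(k <oo) \int[P]_(w in Z @^-1` [set k]) f w)%E.
Proof.
move=> mf f0.
have -> : [set: T] = \bigcup_k (Z @^-1` [set k]).
  by apply/seteqP; split => // w _; exists (Z w).
rewrite ge0_integral_bigcup//.
- by move=> k; exact: measurable_atom.
- by apply: measurable_funTS.
- by apply/trivIsetP => i j _ _ ij; rewrite -preimage_setI; apply/seteqP;
  split => // w [/= -> ji]; rewrite ji eqxx in ij.
Qed.

(** The set [B] allows one count to be integrated over a level set of another, as needed for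
    products of independent counts. *)
Lemma ge0_integral_nat Z F (B : set T) : measurable B -> (forall m, 0 <= F m) ->
  (\int[P]_(w in B) (F (Z w))%:E =
   \sum_(k <oo) (F k)%:E * P (B `&` Z @^-1` [set k]))%E.
Proof.
move=> mB F0; rewrite integral_mkcond.
have mF : measurable_fun [set: T] ((fun w => (F (Z w))%:E) \_ B).
  apply/(measurable_restrictT _ mB).
  by apply/measurable_funTS/measurable_EFinP; exact: measurable_comp_nat.
rewrite (ge0_integral_partition Z)//; last first.
  by move=> w; rewrite patchE; case: ifP => // _; rewrite lee_fin.
apply: eq_eseriesr => k _.
rewrite -integral_mkcondr setIC.
have mBk : measurable (B `&` Z @^-1` [set k]).
  by apply: measurableI => //; exact: measurable_atom.
rewrite -(integral_cst P mBk (F k)%:E); apply: eq_integral => w.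
by rewrite inE => -[_ ->].
Qed.

Lemma expectation_natE Z F : (forall m, 0 <= F m) ->
  ('E_P[fun w => F (Z w)] = \sum_(k <oo) (F k * atom Z k)%R%:E)%E.
Proof.
move=> F0; rewrite unlock ge0_integral_nat//.
by apply: eq_eseriesr => k _; rewrite setTI EFinM atomE.
Qed.

End law_of_counts.

(** * From mean-value identities on finite sums to bounds on expectations *)

Section mean_value_bounds.
Context {d} {T : measurableType d} {R : realType} (P : probability T R).
Variables (Z : {mfun T >-> nat}) (r : nat -> R) (e : R -> nat -> R) (C : R).
Hypothesis mean_value : forall (N : nat) (w : nat -> R), exists2 t : R,
  0 <= t <= 1 & \sum_(m < N) w m * r m = \sum_(m < N) w m * e t m.
Hypothesis e2_le : forall t : R, 0 <= t <= 1 ->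
  ('E_P[fun w => (e t (Z w) ^+ 2)%R] <= C%:E)%E.

Let sqr_Lfun1 (f : nat -> R) : (fun w => f (Z w)) \in Lfun P 2%:E ->
  (fun w => f (Z w) ^+ 2) \in Lfun P 1.
Proof. by move=> Lf; exact: (Lfun2_mul_Lfun1 Lf Lf). Qed.

Lemma intermediate_Lfun2 (t : R) : 0 <= t <= 1 ->
  (fun w => e t (Z w)) \in Lfun P 2%:E.
Proof.
move=> t01; apply: Lfun2_sqr; first exact: measurable_comp_nat.
by rewrite (le_lt_trans (e2_le t01))// ltry.
Qed.

(** With weights [r m * atom P Z m], the truncated second moment of [r] becomes a sum of
    [r m * e t m]. This is at most half the sum for [r] squared plus half that for [e] squared; the
    first half is absorbed, and the bound [C] is uniform in the truncation. *)
Lemma mean_value_sqr_le : ('E_P[fun w => (r (Z w) ^+ 2)%R] <= C%:E)%E.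
Proof.
rewrite (expectation_natE P Z (F := fun m => r m ^+ 2)); last first.
  by move=> m; exact: sqr_ge0.
apply: lime_le.
  by apply: is_cvg_nneseries => k _ _;
    rewrite lee_fin mulr_ge0 ?sqr_ge0 ?atom_ge0.
apply: nearW => N; rewrite sumEFin lee_fin big_mkord.
have [t t01 tE] := mean_value N (fun m => r m * atom P Z m).
have Le := intermediate_Lfun2 t01.
have := expectation_nat_ge_sum N (F := fun m => e t m ^+ 2) (fun m =>
  sqr_ge0 _) (sqr_Lfun1 Le).
have eC : fine ('E_P[fun w => (e t (Z w) ^+ 2)%R])%E <= C.
  by rewrite -lee_fin fineK ?e2_le// expectation_fin_num// sqr_Lfun1.
move=> /le_trans/(_ eC); apply: le_trans.
have : \sum_(m < N) r m ^+ 2 * atom P Z m <=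
   2^-1 * \sum_(m < N) r m ^+ 2 * atom P Z m + 2^-1 * \sum_(m < N) e t m ^+ 2 *
     atom P Z m.
  have {1}-> : \sum_(m < N) r m ^+ 2 * atom P Z m =
    \sum_(m < N) r m * atom P Z m * e t m.
    by rewrite -tE; apply: eq_bigr => m _; ring.
  rewrite !mulr_sumr -big_split/=; apply: ler_sum => m _.
  have := mulr_ge0 (sqr_ge0 (r m - e t m)) (atom_ge0 P Z m).
  by lra.
lra.
Qed.

Lemma remainder_Lfun2 : (fun w => r (Z w)) \in Lfun P 2%:E.
Proof.
apply: Lfun2_sqr; first exact: measurable_comp_nat.
by rewrite (le_lt_trans mean_value_sqr_le)// ltry.
Qed.

(** The weights [c m * atom P Z m] replace [r] by [e t] in a truncated sum, but [t] varies with the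
    truncation [N], so the tail of [c * e t] has to be controlled uniformly in [t]. Young's
    inequality with parameter [del] bounds it by the tail of [c] squared, which tends to 0, plus
    [del / 2 * C]. *)
Lemma mean_value_expectation_le (c : nat -> R) (S : R) :
  (fun w => c (Z w)) \in Lfun P 2%:E ->
  (forall t : R, 0 <= t <= 1 ->
     (`| 'E_P[fun w => (c (Z w) * e t (Z w))%R] | <= S%:E)%E) ->
  (`| 'E_P[fun w => (c (Z w) * r (Z w))%R] | <= S%:E)%E.
Proof.
move=> Lc eS.
have Lcr : (fun w => c (Z w) * r (Z w)) \in Lfun P 1.
  exact: (Lfun2_mul_Lfun1 Lc remainder_Lfun2).
have Lcc := sqr_Lfun1 Lc.
rewrite -(fineK (expectation_fin_num Lcr)) abse_EFin lee_fin.
have cr := cvg_expectation_nat (F := fun m => c m * r m) Lcr.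
have cc := cvg_expectation_nat (F := fun m => c m ^+ 2) Lcc.
set Ecr := fine _ in cr *.
set Ecc := fine _ in cc.
have C0 : 0 <= C.
  rewrite -lee_fin (le_trans _ (e2_le (t := 0) _)) ?lexx ?ler01//.
  by apply: expectation_ge0 => w; exact: sqr_ge0.
apply/ler_addgt0Pr => eps eps0.
(* The denominator [C + 1] is positive even if [C = 0], and [del / 2 * C] is then at most [eps]. *)
pose del := eps / (C + 1).
have del0 : 0 < del by rewrite divr_gt0// ltr_wpDl.
have bound N : `|\sum_(m < N) c m * r m * atom P Z m| <=
    S + (2 * del)^-1 * (Ecc - \sum_(m < N) c m ^+ 2 * atom P Z m) + del / 2 * C.
  have [t t01 tE] := mean_value N (fun m => c m * atom P Z m).
  have Le := intermediate_Lfun2 t01.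
  have Lee := sqr_Lfun1 Le.
  have Lce : (fun w => c (Z w) * e t (Z w)) \in Lfun P 1.
    exact: (Lfun2_mul_Lfun1 Lc Le).
  have -> : \sum_(m < N) c m * r m * atom P Z m =
    \sum_(m < N) c m * e t m * atom P Z m.
    transitivity (\sum_(m < N) c m * atom P Z m * r m);
      first by apply: eq_bigr => m _; ring.
    by rewrite tE; apply: eq_bigr => m _; ring.
  have := eS _ t01; rewrite -(fineK (expectation_fin_num Lce)) abse_EFin
    lee_fin.
  set Ece := fine _.
  have : fine ('E_P[fun w => (e t (Z w) ^+ 2)%R])%E <= C.
    by rewrite -lee_fin fineK ?e2_le// expectation_fin_num.
  set Eee := fine _ => eC.
  (* The signs [s = 1] and [s = -1] give the two sides of the absolute value. *)
  have tail (s : R) : s ^+ 2 = 1 ->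
    s * (Ece - \sum_(m < N) c m * e t m * atom P Z m) <=
    (2 * del)^-1 * (Ecc - \sum_(m < N) c m ^+ 2 * atom P Z m) + del / 2 * Eee.
    move=> s1.
    (* [G] is the square of [c - s * del * e t] divided by [2 * del]. Being nonnegative, its
       expectation dominates its truncated sum, which is the claimed tail bound. *)
    pose G m := c m ^+ 2 * (2 * del)^-1 + e t m ^+ 2 * (del / 2) - c m * e t m
      * s.
    have G0 m : 0 <= G m.
      have -> : G m = (2 * del)^-1 * (c m - s * del * e t m) ^+ 2.
        have -> : (c m - s * del * e t m) ^+ 2 =
          c m ^+ 2 - 2 * s * del * e t m * c m + s ^+ 2 * (del * e t m) ^+ 2 by
            ring.
        by rewrite s1 /G; field; rewrite gt_eqF.
      by rewrite mulr_ge0 ?sqr_ge0// invr_ge0 mulr_ge0// ltW.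
    have LG : (fun w => G (Z w)) \in Lfun P 1.
      by rewrite rpredB ?rpredD ?Lfun_scale.
    have EG : fine ('E_P[fun w => G (Z w)])%E =
        Ecc * (2 * del)^-1 + Eee * (del / 2) - Ece * s.
      have -> : (fun w => G (Z w)) =
        (((2 * del)^-1 \o* (fun w => c (Z w) ^+ 2)) \+
         ((del / 2) \o* (fun w => e t (Z w) ^+ 2))) \-
         (s \o* (fun w => c (Z w) * e t (Z w))) by [].
      rewrite expectationB ?rpredD ?Lfun_scale// expectationD ?Lfun_scale//.
      have Hcc : ('E_P[fun w => (c (Z w) ^+ 2)%R] =
        Ecc%:E)%E by rewrite /Ecc fineK// expectation_fin_num.
      have Hee : ('E_P[fun w => (e t (Z w) ^+ 2)%R] =
        Eee%:E)%E by rewrite /Eee fineK// expectation_fin_num.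
      have Hce : ('E_P[fun w => (c (Z w) * e t (Z w))%R] =
        Ece%:E)%E by rewrite /Ece fineK// expectation_fin_num.
      by rewrite !expectationZl// Hcc Hee Hce /=; ring.
    have := expectation_nat_ge_sum N G0 LG.
    have ee0 : 0 <= \sum_(m < N) e t m ^+ 2 * atom P Z m.
      by apply: sumr_ge0 => m _; rewrite mulr_ge0 ?sqr_ge0 ?atom_ge0.
    have -> : \sum_(m < N) G m * atom P Z m =
      (2 * del)^-1 * (\sum_(m < N) c m ^+ 2 * atom P Z m)
      + del / 2 * (\sum_(m < N) e t m ^+ 2 * atom P Z m)
      - s * (\sum_(m < N) c m * e t m * atom P Z m).
      rewrite !mulr_sumr -big_split -sumrB/=; apply: eq_bigr => m _.
      by rewrite /G; ring.
    have := mulr_ge0 (ltW del0) ee0.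
    rewrite EG; lra.
  have := tail 1 (expr1n _ _).
  have := tail (-1) ltac:(by rewrite sqrrN expr1n).
  have : del / 2 * Eee <= del / 2 * C by rewrite ler_pM2l// divr_gt0.
  rewrite !ler_norml => ? ? ? /andP[? ?]; apply/andP; split; lra.
have lim : (S + (2 * del)^-1 * (Ecc - \sum_(m < N) c m ^+ 2 * atom P Z m) + del
  / 2 * C)
    @[N --> \oo] --> S + (2 * del)^-1 * (Ecc - Ecc) + del / 2 * C.
  apply: cvgD; last exact: cvg_cst.
  apply: cvgD; first exact: cvg_cst.
  by apply: cvgMl_tmp; apply: cvgB => //; exact: cvg_cst.
have : `|Ecr| <= S + (2 * del)^-1 * (Ecc - Ecc) + del / 2 * C.
  apply: (ler_cvg_to (cvg_norm cr) lim).
  by apply: nearW => N; exact: bound.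
rewrite subrr mulr0 addr0 => /le_trans; apply; rewrite lerD2l.
have dC : del * (C + 1) = eps by rewrite /del divfK// gt_eqF// ltr_wpDl.
have := mulr_ge0 (ltW del0) C0.
by move: dC del0; lra.
Qed.

End mean_value_bounds.

(** * Independent Poisson counts *)

Section poisson_moments.
Context {d} {T : measurableType d} {R : realType} (P : probability T R).
Variables (N : {mfun T >-> nat}) (rate : R).
Hypotheses (rate0 : 0 < rate) (poissonN : is_poisson P N rate).

Lemma poisson_atom k : atom P N k = poisson_pmf rate k.
Proof.
apply: EFin_inj; rewrite atomE.
have := poissonN [set k]; rewrite /distribution/= /pushforward => ->.
by rewrite /poisson_prob rate0 esum_set1// lee_fin poisson_pmf_ge0.
Qed.

(* [(k + 1) pmf (k + 1) = rate * pmf k] *)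
Lemma poisson_size_bias (F : nat -> R) : (forall m, 0 <= F m) ->
  ('E_P[fun w => ((N w)%:R * F (N w))%R] = rate%:E * 'E_P[fun w =>
    F (N w).+1])%E.
Proof.
move=> F0.
rewrite (expectation_natE P N (F := fun k => k%:R * F k)); last first.
  by move=> k; rewrite mulr_ge0.
rewrite (expectation_natE P N (F := fun k => F k.+1))//.
rewrite nneseries_recl//; last first.
  by move=> k _; rewrite lee_fin mulr_ge0 ?atom_ge0// mulr_ge0.
rewrite !mul0r add0e -nneseries_addn; last first.
  by move=> k; rewrite lee_fin mulr_ge0 ?atom_ge0// mulr_ge0.
rewrite -nneseriesZl; last first.
  by move=> k _; rewrite lee_fin mulr_ge0 ?atom_ge0.
apply: eq_eseriesr => k _; rewrite -EFinM addn1 !poisson_atom /poisson_pmf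
  rate0.
congr EFin; rewrite exprS factS natrM.
by field; rewrite pnatr_eq0 -lt0n fact_gt0/= addrC natr1 pnatr_eq0.
Qed.

Lemma poisson_mean : ('E_P[fun w => (N w)%:R%R] = rate%:E)%E.
Proof.
under eq_fun do rewrite -[_%:R]mulr1.
rewrite (poisson_size_bias (F := cst 1))//.
by rewrite (expectation_cst P 1) mule1.
Qed.

Lemma poisson_Lfun1 : (fun w => (N w)%:R : R) \in Lfun P 1.
Proof.
apply/Lfun1_integrable/integrableP; split.
  by apply/measurable_EFinP; exact: (measurable_comp_nat N (fun m => m%:R)).
under eq_integral => w _ do rewrite /= ger0_norm//.
by have := poisson_mean; rewrite unlock => ->; rewrite ltry.
Qed.

Lemma poisson_sqr : ('E_P[fun w =>
  ((N w)%:R ^+ 2)%R] = (rate ^+ 2 + rate)%:E)%E.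
Proof.
under eq_fun do rewrite expr2.
rewrite (poisson_size_bias (F := fun k => k%:R))//.
have -> : (fun w => (N w).+1%:R) = (fun w => (N w)%:R : R) \+ cst 1.
  by apply/funext => w /=; rewrite -natr1.
rewrite expectationD ?poisson_Lfun1 ?Lfun_cst// poisson_mean expectation_cst.
by rewrite -EFinD -EFinM; congr EFin; ring.
Qed.

Lemma poisson_Lfun2 : (fun w => (N w)%:R : R) \in Lfun P 2%:E.
Proof.
apply: Lfun2_sqr; first exact: (measurable_comp_nat N (fun m => m%:R)).
by rewrite poisson_sqr ltry.
Qed.

End poisson_moments.

Section independent_counts.
Context {d} {T : measurableType d} {R : realType} (P : probability T R).
Context {n : nat} (X : 'I_n -> {mfun T >-> nat}).

Lemma independent_pair_atom (i h : 'I_n) (j k : nat) : i != h ->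
  mutually_independent P X ->
  (P (X h @^-1` [set k] `&` X i @^-1` [set j]) =
   P (X h @^-1` [set k]) * P (X i @^-1` [set j]))%E.
Proof.
(* Joint independence is specialized to the pair of indices, with the event [[set j]] at [i] and
   [[set k]] at [h]. *)
move=> ih /(_ [set i; h]%SET (fun l => if l == i then [set j] else [set k])).
have -> : (\bigcap_(l in [set l0 | l0 \in [set i; h]%SET])
    (X l @^-1` (if l == i then [set j] else [set k])))%classic =
    X h @^-1` [set k] `&` X i @^-1` [set j].
  apply/seteqP; split => w.
    move=> H; split.
      by have := H h; rewrite /= eq_sym (negbTE ih) => ->//;
        rewrite !inE eqxx orbT.
    by have := H i; rewrite /= eqxx => ->//; rewrite !inE eqxx.
  move=> [wh wi] l /=; rewrite !inE => /orP[] /eqP ->; first by rewrite eqxx.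
  by rewrite eq_sym (negbTE ih).
move=> ->; last by move=> l; case: ifP.
by rewrite big_setU1 ?inE//= big_set1 eqxx eq_sym (negbTE ih) muleC.
Qed.

(** The integral is split over the level sets of [X h]. On each of them [X h] is a constant [k], and
    pairwise independence of atoms extracts [Ei], whose finiteness allows it to leave the series. *)
Lemma independent_expectationM (i h : 'I_n) : i != h ->
  mutually_independent P X -> (fun w => (X i w)%:R : R) \in Lfun P 1 ->
  ('E_P[fun w => ((X i w)%:R * (X h w)%:R)%R] =
   'E_P[fun w => (X i w)%:R%R] * 'E_P[fun w => (X h w)%:R%R])%E.
Proof.
move=> ih indep Li; have := expectation_fin_num Li; rewrite unlock => fEi.
have mXX : measurable_fun [set: T] (fun w => ((X i w)%:R * (X h w)%:R : R)%:E).
  apply/measurable_EFinP; apply: measurable_funM.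
    exact: (measurable_comp_nat (X i) (fun m => m%:R)).
  exact: (measurable_comp_nat (X h) (fun m => m%:R)).
rewrite (ge0_integral_partition P (X h))//.
set Ei := (X in _ = (X * _)%E); rewrite -/Ei in fEi.
have EiE : Ei = (\sum_(j <oo) j%:R%:E * P (X i @^-1` [set j]))%E.
  rewrite /Ei (ge0_integral_nat P (X i) measurableT (F := fun j => j%:R))//.
  by apply: eq_eseriesr => j _; rewrite setTI.
have Ei0 : (0 <= Ei)%E by apply: integral_ge0 => w _; rewrite lee_fin.
rewrite (ge0_integral_nat P (X h) measurableT (F := fun j => j%:R))//.
have -> : (\sum_(k <oo) \int[P]_(w in X h @^-1` [set k]) ((X i w)%:R * (X h
  w)%:R)%:E =
  \sum_(k <oo) Ei * (k%:R%:E * P ([set: T] `&` X h @^-1` [set k])))%E.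
  apply: eq_eseriesr => k _; rewrite setTI.
  transitivity (\int[P]_(w in X h @^-1` [set k]) (k%:R%:E * (X i w)%:R%:E))%E.
    by apply: eq_integral => w; rewrite inE/= => ->; rewrite mulrC EFinM.
  rewrite ge0_integralZl_EFin//; last 2 first.
  - exact: measurable_atom.
  - apply/measurable_funTS/measurable_EFinP.
    exact: (measurable_comp_nat (X i) (fun m => m%:R)).
  rewrite (ge0_integral_nat P (X i) _ (F := fun j => j%:R))//;
    last exact: measurable_atom.
  rewrite EiE.
  under eq_eseriesr do rewrite independent_pair_atom// muleCA -(atomE P (X h)).
  rewrite nneseriesZl; last first.
    by move=> j _; rewrite mule_ge0// lee_fin.
  by rewrite (atomE P (X h)) muleA muleC.
rewrite -(fineK fEi) nneseriesZl// => k _.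
by rewrite mule_ge0// lee_fin.
Qed.

End independent_counts.

(** * Coding a vector of counts by a single natural number *)

Section count_vector.
Context {d} {T : measurableType d} {R : realType} {n : nat}.
Variable X : 'I_n -> {mfun T >-> nat}.

(** Vectors of naturals are countable; through this code the results on one [nat]-valued variable
    apply to functions of the whole vector. *)
Definition count_code (w : T) : nat := pickle [ffun i => X i w].

(** Numbers that code nothing decode to the zero vector, so every value is a vector of naturals, at
    which the regularity of the estimator can be used. *)
Definition count_decode (m : nat) : 'rV[R]_n :=
  \row_i (odflt [ffun=> 0%N] (unpickle m : option {ffun 'I_n -> nat}) i)%:R.

Lemma real_countsE w : real_counts X w = count_decode (count_code w).
Proof.
by apply/rowP => i; rewrite !mxE /count_code pickleK /= ffunE.
Qed.

(** A preimage is a countable union of level sets, each of them empty or a finite intersection of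
    events on the [X i]. *)
Lemma measurable_count_code : measurable_fun [set: T] count_code.
Proof.
move=> _ A _; rewrite setTI.
have -> : count_code @^-1` A = \bigcup_(m in A) (count_code @^-1` [set m]).
  by apply/seteqP; split => [w Aw|w [m Am wm]];
    [exists (count_code w)|rewrite /= wm].
apply: bigcup_measurable => m _.
have [[f fm]|nf] := pselect (exists f : {ffun 'I_n -> nat}, pickle f = m).
  have -> : count_code @^-1` [set m] =
      \bigcap_(i in [set: 'I_n]) (X i @^-1` [set f i]).
    apply/seteqP; split => w.
      move=> wm i _; have <- : [ffun i =>
        X i w] = f by apply: (pcan_inj pickleK); rewrite fm.
      by rewrite /= ffunE.
    move=> H; rewrite /= -fm; congr pickle; apply/ffunP => i.
    by rewrite ffunE; exact: H.
  apply: fin_bigcap_measurable => // i _; exact: measurable_funPTI.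
rewrite (_ : _ @^-1` _ = set0)//; apply/seteqP; split => // w wm.
by case: nf; exists [ffun i => X i w].
Qed.

HB.instance Definition _ := isMeasurableFun.Build _ _ _ _ count_code
  measurable_count_code.

End count_vector.

(** * Moments of a second-order expansion *)

Section expectation_extra.
Context {d} {T : measurableType d} {R : realType} (P : probability T R).

Lemma expectation_sum_ord {n : nat} (F : 'I_n -> T -> R) :
  (forall i, F i \in Lfun P 1) ->
  ('E_P[fun w => (\sum_i F i w)%R] = \sum_i 'E_P[F i])%E.
Proof.
move=> LF.
have := @expectation_sum _ _ _ P [seq F i | i <- index_enum 'I_n].
rewrite !big_map => <-; last by move=> _ /mapP[i _ ->].
by congr expectation; apply/funext => w; rewrite fct_sumE.
Qed.

(** The squares of [c + e] and [c - e] have nonnegative expectation. This bound serves only to show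
    that the maxima over [t] are finite. *)
Lemma expectationM_le (c e : T -> R) (A B : R) :
  c \in Lfun P 2%:E -> e \in Lfun P 2%:E ->
  ('E_P[fun w => (c w ^+ 2)%R] <= A%:E)%E ->
  ('E_P[fun w => (e w ^+ 2)%R] <= B%:E)%E ->
  (`| 'E_P[fun w => (c w * e w)%R] | <= ((A + B) / 2)%:E)%E.
Proof.
move=> Lc Le cA eB.
have Lcc : (fun w => c w ^+ 2) \in Lfun P 1 by exact: (Lfun2_mul_Lfun1 Lc Lc).
have Lee : (fun w => e w ^+ 2) \in Lfun P 1 by exact: (Lfun2_mul_Lfun1 Le Le).
have Lce : (fun w => c w * e w) \in Lfun P 1 by exact: (Lfun2_mul_Lfun1 Lc Le).
have H (s : R) : s ^+ 2 = 1 -> (0 <= 'E_P[fun w => (c w ^+ 2)%R] +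
    'E_P[fun w => (e w ^+ 2)%R] + (2 * s)%:E * 'E_P[fun w => (c w * e w)%R])%E.
  move=> s1; rewrite -expectationZl// -!expectationD ?rpredD ?Lfun_scale//.
  apply: expectation_ge0 => w /=.
  have -> : c w ^+ 2 + e w ^+ 2 + c w * e w * (2 * s) =
    (c w + s * e w) ^+ 2 + (1 - s ^+ 2) * e w ^+ 2 by ring.
  by rewrite s1 subrr mul0r addr0 sqr_ge0.
have := H (-1) ltac:(by rewrite sqrrN expr1n).
have := H 1 (expr1n _ _).
move: cA eB; rewrite -(fineK (expectation_fin_num Lcc))
  -(fineK (expectation_fin_num Lee)) -(fineK (expectation_fin_num Lce)).
set x := fine _; set y := fine _; set z := fine _.
rewrite -!EFinM -!EFinD abse_EFin !lee_fin => ? ? ? ?.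
rewrite ler_norml; apply/andP; split; lra.
Qed.

End expectation_extra.

Section second_order_moments.
Context {d} {T : measurableType d} {R : realType} (P : probability T R).
Variables (Z : {mfun T >-> nat}) (r : nat -> R) (e : R -> nat -> R) (C : R).
Hypothesis mean_value : forall (N : nat) (w : nat -> R), exists2 t : R,
  0 <= t <= 1 & \sum_(m < N) w m * r m = \sum_(m < N) w m * e t m.
Hypothesis e2_le : forall t : R, 0 <= t <= 1 ->
  ('E_P[fun w => (e t (Z w) ^+ 2)%R] <= C%:E)%E.
Variables (c : nat -> R) (a v S1 S2 : R).
Hypothesis Lc : (fun w => c (Z w)) \in Lfun P 2%:E.
Hypothesis Ec : ('E_P[fun w => c (Z w)] = 0)%E.
Hypothesis Ecc : ('E_P[fun w => (c (Z w) ^+ 2)%R] = v%:E)%E.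
Hypothesis eS1 : forall t : R, 0 <= t <= 1 ->
  (`| 'E_P[fun w => e t (Z w)] | <= S1%:E)%E.
Hypothesis eS2 : forall t : R, 0 <= t <= 1 ->
  (`| 'E_P[fun w => (c (Z w) * e t (Z w))%R] | <= S2%:E)%E.

Let Lr : (fun w => r (Z w)) \in Lfun P 2%:E.
Proof. exact: remainder_Lfun2 mean_value e2_le. Qed.

Let L21 (f : T -> R) : f \in Lfun P 2%:E -> f \in Lfun P 1.
Proof. by apply: Lfun_subset12; rewrite fin_num_measure. Qed.

Let Er_le : (`| 'E_P[fun w => r (Z w)] | <= S1%:E)%E.
Proof.
(* The bound on the expectation of a product is used with the constant 1 as first factor. *)
have mul1 (f : T -> R) : (fun w => cst 1 (Z w) * f w) = f.
  by apply/funext => w; rewrite mul1r.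
rewrite -[X in 'E_P[X]%E]mul1;
  apply: (mean_value_expectation_le mean_value e2_le (c := cst 1)).
  exact: Lfun_cst.
by move=> t t01; rewrite mul1; exact: eS1.
Qed.

Lemma second_order_expectation :
  (`| 'E_P[fun w => (a + c (Z w) + r (Z w))%R] - a%:E | <= S1%:E)%E.
Proof.
have -> : (fun w => a + c (Z w) + r (Z w)) =
  (cst a \+ (fun w => c (Z w))) \+ (fun w => r (Z w)) by [].
rewrite !expectationD ?rpredD ?Lfun_cst ?L21//.
rewrite expectation_cst Ec adde0 addeAC subee// add0e; exact: Er_le.
Qed.

(** The variance is [v] plus the variance of [r] plus twice a covariance. The second term lies
    between 0 and [C]; as [c] is centered, the covariance is the expectation of [c * r], at most
    [S2] in absolute value. *)
Lemma second_order_variance :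
  ((v - (C + 2 * S2))%:E <= 'V_P[fun w => (a + c (Z w) + r (Z w))%R]
     <= (v + (C + 2 * S2))%:E)%E.
Proof.
have -> : (fun w => a + c (Z w) + r (Z w)) =
    cst a \+ ((fun w => c (Z w)) \+ (fun w => r (Z w))).
  by apply/funext => w /=; rewrite addrA.
have Lcr2 : (fun w => c (Z w)) \+ (fun w => r (Z w)) \in Lfun P 2%:E.
  by rewrite rpredD ?lee1n.
rewrite varianceD_cst_l// varianceD//.
have Lcr : (fun w => c (Z w) * r (Z w)) \in Lfun P 1.
  exact: (Lfun2_mul_Lfun1 Lc Lr).
have Lrr : (fun w => r (Z w) ^+ 2) \in Lfun P 1.
  exact: (Lfun2_mul_Lfun1 Lr Lr).
have -> : ('V_P[fun w => c (Z w)] = v%:E)%E.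
  by rewrite varianceE// Ec expe2 mule0 sube0; exact: Ecc.
have -> : covariance P (fun w => c (Z w)) (fun w => r (Z w)) =
    ('E_P[fun w => (c (Z w) * r (Z w))%R])%E.
  have Lc1 := L21 Lc; have Lr1 := L21 Lr.
  rewrite covarianceE//.
  by rewrite Ec mul0e sube0.
have V0 := variance_ge0 P (fun w => r (Z w)).
have VC : ('V_P[fun w => r (Z w)] <= C%:E)%E.
  rewrite varianceE//; apply: le_trans (mean_value_sqr_le mean_value e2_le).
  have := expectation_fin_num (L21 Lr) => /fineK <-.
  rewrite -EFin_expe leeBlDr// leeDl// lee_fin sqr_ge0//.
have crS := mean_value_expectation_le mean_value e2_le Lc eS2.
have fV := variance_fin_num Lr.
move: V0 VC crS; rewrite -(fineK fV) -(fineK (expectation_fin_num Lcr)).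
move: (fine _) (fine _) => x y.
rewrite abse_EFin !lee_fin ler_norml => ? ? /andP[? ?].
by apply/andP; split; lra.
Qed.

End second_order_moments.

Section max_over_unit_interval.
Context {R : realType}.
Implicit Type f : R -> \bar R.

Lemma max01_ge f (t : R) : 0 <= t <= 1 -> (f t <= max01 f)%E.
Proof. by move=> t01; apply: ereal_sup_ubound; exists t => //=;
  rewrite in_itv. Qed.

Lemma max01_fin_num f (B : R) : (forall t :
  R, (0 <= t <= 1)%R -> (0 <= f t)%E) ->
  (forall t : R, 0 <= t <= 1 -> (f t <= B%:E)%E) -> max01 f \is a fin_num.
Proof.
move=> f0 fB; rewrite ge0_fin_numE.
  apply: (@le_lt_trans _ _ B%:E); last by rewrite ltry.
  by apply: ge_ereal_sup => _ [t /= t01 <-]; apply: fB; rewrite in_itv in t01.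
by apply: le_trans (max01_ge f (t := 0) _); [apply: f0|]; rewrite lexx ler01.
Qed.

End max_over_unit_interval.

Lemma pixel_response_ge0 {R : realType} {n : nat} (sigma dx : R) (x : 'I_n -> R)
    (xc : R) (i : 'I_n) : 0 <= pixel_response sigma dx x xc i.
Proof. by apply: Rintegral_ge0 => u _; exact: normal_pdf_ge0. Qed.

(** * Means, covariances and centered linear statistics of Poisson counts *)

Section poisson_counts.
Context {d} {T : measurableType d} {R : realType} (P : probability T R).
Context {n : nat} (X : 'I_n -> {mfun T >-> nat}) (lam : 'I_n -> R).
Hypothesis lam0 : forall i, 0 < lam i.
Hypothesis indepX : mutually_independent P X.
Hypothesis poissonX : forall i, is_poisson P (X i) (lam i).
Let I : T -> 'rV[R]_n := real_counts X.
Let Ibar : 'rV[R]_n := \row_i lam i.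

Let IE i : (fun w => I w 0 i) = (fun w => (X i w)%:R).
Proof. by apply/funext => w; rewrite mxE. Qed.

Lemma counts_mean i : ('E_P[fun w => I w 0%R i] = (Ibar 0%R i)%:E)%E.
Proof. by rewrite IE (poisson_mean (lam0 i) (poissonX i)) mxE. Qed.

Lemma counts_Lfun2 i : (fun w => I w 0 i) \in Lfun P 2%:E.
Proof. by rewrite IE; exact: poisson_Lfun2 (poissonX i). Qed.

Lemma counts_Lfun1 i : (fun w => I w 0 i) \in Lfun P 1.
Proof. by rewrite IE; exact: poisson_Lfun1 (poissonX i). Qed.

Lemma centered_count_Lfun2 i :
  (fun w => I w 0 i) \- cst (Ibar 0 i) \in Lfun P 2%:E.
Proof.
have Li := counts_Lfun2 i; have Lc := Lfun_cst P (Ibar 0 i) 2.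
by rewrite rpredB ?lee1n.
Qed.

Lemma counts_covariance i h :
  covariance P (fun w => I w 0 i) (fun w => I w 0 h) = (diag_mx Ibar i h)%:E.
Proof.
have Li := counts_Lfun1 i; have Lh := counts_Lfun1 h.
have Lih : (fun w => I w 0 i) * (fun w => I w 0 h) \in Lfun P 1.
  exact: (Lfun2_mul_Lfun1 (counts_Lfun2 i) (counts_Lfun2 h)).
rewrite covarianceE// !counts_mean !mxE.
have [<-|ih] := eqVneq i h.
  rewrite mulr1n.
  have -> : (fun w => I w 0 i) * (fun w => I w 0 i) = (fun w =>
    (X i w)%:R ^+ 2).
    by rewrite IE.
  rewrite (poisson_sqr (lam0 i) (poissonX i)) -EFinM -EFinB.
  by congr EFin; ring.
have -> : (fun w => I w 0 i) * (fun w => I w 0 h) = (fun w =>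
  (X i w)%:R * (X h w)%:R).
  by rewrite !IE.
rewrite independent_expectationM//; last by rewrite -IE.
by rewrite -!IE !counts_mean !mxE mulr0n -EFinM subee.
Qed.

Variable a : 'I_n -> R.
Let L w : R := \sum_h a h * (I w 0 h - Ibar 0 h).

Let centered_Lfun2 h : (fun w => a h * (I w 0 h - Ibar 0 h)) \in Lfun P 2%:E.
Proof.
rewrite (_ : (fun w => _) = a h \o* ((fun w => I w 0 h) \- cst (Ibar 0 h))).
  by apply: Lfun_scale; [exact: ler1n | exact: centered_count_Lfun2].
by apply/funext => w /=; rewrite mulrC.
Qed.

Let L21 (f : T -> R) : f \in Lfun P 2%:E -> f \in Lfun P 1.
Proof. by apply: Lfun_subset12; rewrite fin_num_measure. Qed.

Lemma centered_linear_Lfun2 : L \in Lfun P 2%:E.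
Proof.
rewrite (_ : L = \sum_h (fun w => a h * (I w 0 h - Ibar 0 h))).
  by rewrite rpred_sum ?lee1n// => h _.
by apply/funext => w; rewrite fct_sumE.
Qed.

Lemma centered_linear_mean : ('E_P[L] = 0)%E.
Proof.
rewrite expectation_sum_ord; last by move=> h; exact: L21.
rewrite big1// => h _.
rewrite (_ : (fun w => _) = a h \o* ((fun w => I w 0 h) \- cst (Ibar 0 h))).
  have Li := counts_Lfun1 h; have Lk := Lfun_cst P (Ibar 0 h) 1.
  have Lik := L21 (centered_count_Lfun2 h).
  rewrite expectationZl// expectationB//.
  by rewrite (counts_mean h) expectation_cst subee// mule0.
by apply/funext => w /=; rewrite mulrC.
Qed.

(** The square expands into a double sum of covariances, of which only the diagonal ones survive. *)
Lemma centered_linear_sqr :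
  ('E_P[fun w => (L w ^+ 2)%R] = (\sum_h a h ^+ 2 * lam h)%R%:E)%E.
Proof.
have -> : (fun w => L w ^+ 2) = (fun w => \sum_i \sum_h
    (a i * (I w 0 i - Ibar 0 i)) * (a h * (I w 0 h - Ibar 0 h))).
  apply/funext => w; rewrite expr2 /L mulr_suml; apply: eq_bigr => i _.
  by rewrite mulr_sumr.
have Lih i h : (fun w => (a i * (I w 0 i - Ibar 0 i)) * (a h * (I w 0 h - Ibar
  0 h))) \in Lfun P 1.
  exact: (Lfun2_mul_Lfun1 (centered_Lfun2 i) (centered_Lfun2 h)).
have Eih i h : ('E_P[fun w =>
  ((a i * (I w 0%R i - Ibar 0%R i)) * (a h * (I w 0%R h - Ibar 0%R h)))%R]
   = (a i * a h * diag_mx Ibar i h)%R%:E)%E.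
  have Lc k : (fun w => I w 0 k) \- cst (Ibar 0 k) \in Lfun P 2%:E.
    exact: centered_count_Lfun2.
  have Lcc := Lfun2_mul_Lfun1 (Lc i) (Lc h).
  rewrite EFinM -counts_covariance covariance.unlock !counts_mean/=.
  rewrite -expectationZl//; congr expectation.
  by apply/funext => w; rewrite /= !fctE/=; ring.
rewrite (expectation_sum_ord (F := fun i w =>
  \sum_h (a i * (I w 0 i - Ibar 0 i)) * (a h * (I w 0 h - Ibar 0 h))));
  last first.
  move=> i; rewrite (_ : (fun w => _) = \sum_h (fun w =>
    (a i * (I w 0 i - Ibar 0 i)) * (a h * (I w 0 h - Ibar 0 h)))).
    by rewrite rpred_sum.
  by apply/funext => w; rewrite fct_sumE.
under eq_bigr do (rewrite expectation_sum_ord//; under eq_bigr do rewrite Eih).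
under eq_bigr do rewrite sumEFin.
rewrite sumEFin; congr EFin; apply: eq_bigr => i _.
rewrite (bigD1 i)//= big1 ?addr0; last first.
  by move=> h; rewrite eq_sym !mxE => /negbTE ->; rewrite mulr0n mulr0.
by rewrite !mxE eqxx mulr1n expr2.
Qed.

End poisson_counts.

(** * The expansion of the estimator, indexed by codes *)

Section second_order_expansion.
Context {R : realType} {n : nat} (f : 'rV[R]_n -> R) (Ibar : 'rV[R]_n).
Hypothesis fC2 : forall k : 'I_n -> nat, forall t : R, 0 <= t < 1 ->
  C2_near f (segment_point Ibar (\row_i (k i)%:R) t).
Hypothesis f1 : forall k : 'I_n -> nat,
  f (segment_point Ibar (\row_i (k i)%:R) t) @[t --> 1^'-] --> f (\row_i (k
    i)%:R).

Definition code_linear (m : nat) : R :=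
  \sum_h partial h f Ibar * (count_decode (R := R) m 0 h - Ibar 0 h).

Definition code_remainder (m : nat) : R :=
  f (count_decode m) - f Ibar - code_linear m.

(** This is the hypothesis [mean_value] of the moment bounds, with [e t m] the Taylor term at the
    decoded data. *)
Lemma code_mean_value (N : nat) (w : nat -> R) : exists2 t : R, 0 <= t <= 1 &
  \sum_(m < N) w m * code_remainder m =
  \sum_(m < N) w m * taylor2 f Ibar t (count_decode m).
Proof.
have [|m|xi /andP[xi0 xi1] E] := @taylor2_sum R n N f Ibar
    (fun m => count_decode (R := R) m) (fun m => w m).
- by move=> m t t01; exact: fC2.
- exact: f1.
by exists xi; rewrite ?(ltW xi0) ?(ltW xi1).
Qed.

End second_order_expansion.

(** * Bias and variance bounds for the maximum likelihood estimator *)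

Theorem theorem6p1 (R : realType) (n : nat)
  (sigma dx : R) (x : 'I_n -> R) (xc : R) (alpha : 'rV[R]_2)
  (d : measure_display) (T : measurableType d) (P : probability T R)
  (X : 'I_n -> {mfun T >-> nat}) (tau : 'rV[R]_n -> 'rV[R]_2) :
  let g := pixel_response sigma dx x xc in
  let lam := intensity g alpha in
  let Ibar : 'rV[R]_n := \row_i lam i in
  let K := diag_mx Ibar in
  let I : T -> 'rV[R]_n := real_counts X in
  let J := J_ML g in
  let D := jacobian_col tau Ibar in
  let sigma2 := D *m K *m D^T in
  0 < sigma -> 0 < dx ->
  (forall i j : 'I_n, j = i.+1 :> nat -> x j - x i = dx) ->
  param_space alpha ->
  mutually_independent P X ->
  (forall i, is_poisson P (X i) (lam i)) ->
  is_ML_estimator g tau ->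
  nabla20 J (tau Ibar) Ibar \in unitmx ->
  regular_estimator tau Ibar ->
  (forall j, (max_sqr_remainder P tau Ibar I j < +oo)%E) ->
  [/\ (forall i, ('E_P[fun w => I w 0%R i] = (Ibar 0%R i)%:E)%E) /\
      (forall i h, covariance P (fun w => I w 0 i) (fun w => I w 0 h)
                   = (K i h)%:E),
      D = - invmx (nabla20 J (tau Ibar) Ibar) *m nabla11 J (tau Ibar) Ibar,
      nabla11 J (tau Ibar) Ibar =
        col_mx (\row_i (- g i / lam i)) (\row_i (- 1 / lam i))
        :> 'M[R]_(1 + 1, n),
      nabla20 J (tau Ibar) Ibar =
        block_mx (\sum_i g i ^+ 2 / lam i)%:M (\sum_i g i / lam i)%:M
                 (\sum_i g i / lam i)%:M      (\sum_i 1 / lam i)%:M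
        :> 'M[R]_(1 + 1, 1 + 1)
    & forall j : 'I_2, exists eps beta : R,
        [/\ eps%:E = eps_ML P tau Ibar I alpha j,
            beta%:E = beta_ML P tau Ibar I j,
            0 <= eps /\
            ((forall t, t \in `[0, 1] -> ('E_P[remainder tau Ibar I j t] = 0)%E)
             \/ 0 < eps),
            (`| 'E_P[fun w => tau (I w) 0%R j] - (alpha 0%R j)%:E | <= eps%:E)%E
          & ((sigma2 j j - beta)%:E <= 'V_P[fun w => tau (I w) 0%R j]
              <= (sigma2 j j + beta)%:E)%E]].
Proof.
move=> g lam Ibar K I J D sigma2 _ _ _ pos_alpha indepX poissonX tau_ML unitH
  regtau Clty.
have g0 i : 0 <= g i by exact: pixel_response_ge0.
have lam0 i : 0 < lam i by exact: param_space_intensity_gt0.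
have fC2 (j : 'I_2) (k : 'I_n -> nat) (t : R) : 0 <= t < 1 ->
    C2_near (fun q => tau q 0 j) (segment_point Ibar (\row_i (k i)%:R) t).
  by move=> t01; have [/(_ j t t01)] := regtau k.
have f1 (j : 'I_2) (k : 'I_n -> nat) :
    tau (segment_point Ibar (\row_i (k i)%:R) t) 0 j @[t --> 1^'-] -->
    tau (\row_i (k i)%:R) 0 j.
  have [_ H] := regtau k.
  by apply: (cvg_comp _ (fun q : 'rV[R]_2 => q 0 j) H); exact: coord_continuous.
have dtau (j : 'I_2) : differentiable (fun q => tau q 0 j) Ibar.
  (* Every segment starts at [Ibar]; the one towards zero counts is taken at [t = 0]. *)
  have := fC2 j (fun=> 0%N) 0; rewrite lexx ltr01 => /(_ isT).
  by rewrite /segment_point scale0r addr0 => /nbhs_singleton[].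
split.
- by split; [exact: counts_mean | exact: counts_covariance].
- exact: ML_jacobian.
- exact: nabla11_ML_mean_mx.
- exact: nabla20_ML_mean_mx.
move=> j.
pose f q := tau q 0 j.
pose Z : {mfun T >-> nat} := count_code X.
have IE w : I w = count_decode (Z w) by exact: real_countsE.
pose C := fine (max_sqr_remainder P tau Ibar I j).
have CE : max_sqr_remainder P tau Ibar I j = C%:E.
  rewrite /C fineK// ge0_fin_numE; first exact: Clty.
  apply: le_trans (max01_ge (t := 0) _ _); last by rewrite lexx ler01.
  by apply: expectation_ge0 => w; exact: sqr_ge0.
pose e t m := taylor2 f Ibar t (count_decode (n := n) m).
have eE t : remainder tau Ibar I j t = (fun w => e t (Z w)).
  by apply/funext => w; rewrite /remainder IE.
have e2_le (t : R) : 0 <= t <= 1 -> ('E_P[fun w =>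
  (e t (Z w) ^+ 2)%R] <= C%:E)%E.
  move=> t01; rewrite -CE; apply: le_trans (max01_ge _ t01).
  by rewrite eE.
have mv := @code_mean_value R n f Ibar (fC2 j) (f1 j).
pose c := code_linear f Ibar.
have cE : linear_part tau Ibar I j = (fun w => c (Z w)).
  apply/funext => w; rewrite /linear_part !mxE; apply: eq_bigr => h _.
  by rewrite mxE jacobian_colE// mxE mxE IE mxE mxE.
have cE' : (fun w => c (Z w)) = (fun w =>
  \sum_h partial h f Ibar * (I w 0 h - Ibar 0 h)).
  by apply/funext => w; rewrite /c /code_linear -IE.
have Lc : (fun w => c (Z w)) \in Lfun P 2%:E.
  by rewrite cE'; exact: centered_linear_Lfun2.
have Ec : ('E_P[fun w => c (Z w)] = 0)%E.
  by rewrite cE'; exact: centered_linear_mean.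
pose v := \sum_h partial h f Ibar ^+ 2 * lam h.
have Ecc : ('E_P[fun w => (c (Z w) ^+ 2)%R] = v%:E)%E.
  rewrite -(centered_linear_sqr lam0 indepX poissonX (fun h =>
    partial h f Ibar)).
  by congr expectation; apply/funext => w; rewrite (congr1 (fun u => u w) cE').
(* As [K] is diagonal, the diagonal entry of [sigma2] is the variance of the linear part. *)
have vE : sigma2 j j = v.
  rewrite mxE; apply: eq_bigr => h _.
  rewrite mul_mx_diag mxE [X in _ * X]mxE /D jacobian_colE// mxE.
  by rewrite -/f; ring.
have Le t : 0 <= t <= 1 -> (fun w => e t (Z w)) \in Lfun P 2%:E.
  exact: (intermediate_Lfun2 e2_le).
(* The crude bounds [eB1] and [eB2], uniform in [t], make the suprema real numbers [S1] and [S2]. *)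
have eB1 t : 0 <= t <= 1 -> (`| 'E_P[fun w =>
  e t (Z w)] | <= ((1 + C) / 2)%:E)%E.
  move=> t01.
  have -> : (fun w => e t (Z w)) = (fun w => cst 1 w * e t (Z w)).
    by apply/funext => w; rewrite mul1r.
  apply: expectationM_le; [exact: Lfun_cst | exact: Le | | exact: e2_le].
  by rewrite (_ : (fun w => _) = cst 1) ?expectation_cst//; apply/funext => w;
    rewrite expr1n.
have eB2 t : 0 <= t <= 1 ->
    (`| 'E_P[fun w => (c (Z w) * e t (Z w))%R] | <= ((v + C) / 2)%:E)%E.
  move=> t01; apply: expectationM_le; [exact: Lc | exact: Le | | exact: e2_le].
  by rewrite Ecc.
pose S1 := fine (max01 (fun t => `| 'E_P[remainder tau Ibar I j t] |)%E).
have S1E : max01 (fun t => `| 'E_P[remainder tau Ibar I j t] |)%E = S1%:E.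
  rewrite /S1 fineK//; apply: (@max01_fin_num _ _ ((1 + C) / 2)) => t t01.
    exact: abse_ge0.
  by rewrite eE; exact: eB1.
pose F2 t := (`| 'E_P[fun w =>
  (linear_part tau Ibar I j w * remainder tau Ibar I j t w)%R] |)%E.
have F2E t : (F2 t = `| 'E_P[fun w => (c (Z w) * e t (Z w))%R] |)%E.
  by rewrite /F2 cE eE.
pose S2 := fine (max01 F2).
have S2E : max01 F2 = S2%:E.
  rewrite /S2 fineK//; apply: (@max01_fin_num _ _ ((v + C) / 2)) => t t01.
    exact: abse_ge0.
  by rewrite F2E; exact: eB2.
have eS1 t : 0 <= t <= 1 -> (`| 'E_P[fun w => e t (Z w)] | <= S1%:E)%E.
  by move=> t01; rewrite -S1E -eE;
    exact: (max01_ge (fun t => `| 'E_P[remainder tau Ibar I j t] |)%E).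
have eS2 t : 0 <= t <= 1 -> (`| 'E_P[fun w =>
  (c (Z w) * e t (Z w))%R] | <= S2%:E)%E.
  by move=> t01; rewrite -S2E -F2E; exact: max01_ge.
have tauE : (fun w => tau (I w) 0 j) =
    (fun w => f Ibar + c (Z w) + code_remainder f Ibar (Z w)).
  apply/funext => w; rewrite /code_remainder -IE /c /f; ring.
have S10 : 0 <= S1.
  by rewrite -lee_fin (le_trans _ (eS1 0 _))// ?lexx ?ler01// abse_ge0.
exists (`|tau Ibar 0 j - alpha 0 j| + S1), (C + 2 * S2); split.
- by rewrite /eps_ML S1E.
- by rewrite /beta_ML CE S2E.
- split; first by rewrite addr_ge0.
  (* If [S1] is not positive, every expected remainder vanishes; this is the degenerate alternative
     of the statement. *)
  have [S1pos|] := ltP 0 S1; first by right; rewrite ltr_wpDl.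
  move=> S1le; left => t; rewrite in_itv/= => t01.
  have := eS1 _ t01; rewrite -eE => /le_trans/(_ (_ : S1%:E <= 0)%E).
  rewrite lee_fin => /(_ S1le) E0; apply/eqP.
  by rewrite -abse_eq0 eq_le E0 abse_ge0.
- have := second_order_expectation mv e2_le (f Ibar) Lc Ec eS1.
  rewrite tauE; move: ('E_P[_])%E => [y| |]//;
    rewrite -!EFinB !abse_EFin !lee_fin => yS.
  (* The bias splits into the deterministic error at [Ibar] and the expected remainder. *)
  rewrite (_ : y - alpha 0 j = (tau Ibar 0 j - alpha 0 j) + (y - f Ibar));
    last by rewrite /f; ring.
  by rewrite (le_trans (ler_normD _ _))// lerD2l.
- by rewrite vE tauE; exact: (second_order_variance mv e2_le _ Lc Ec Ecc eS2).
Qed.
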